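(* Let $(M,g_L)$ be an oriented Lorentzian 4-manifold, $T$ a unit timelike vector field on $M$, and $h$ the Riemannian metric $h:=g_L+2T^\flat\otimes T^\flat$, where $T^\flat:=g_L(T,\cdot)$. (a) $(M,g_L)$ is $*_h$-Einstein with respect to $h$, i.e. $\hat R^h_L\circ *_h=*_h\circ\hat R^h_L$, if and only if $$\mathrm{tr}_h(\mathrm{Rm}_L)=f\,h$$ for some smooth function $f$ on $M$, where $\mathrm{Rm}_L$ is the Riemann curvature 4-tensor of $g_L$. (b) If $(M,g_L)$ is $*_h$-Einstein with respect to $h$, then it has a unique normal form that is completely determined by the critical points and values of the quadratic form $P\mapsto\langle\hat R^h_LP,P\rangle_h$, defined for all 2-planes $P$. Precisely, at every $p\in M$: there is an $h$-orthonormal basis $\{e_1,e_2,e_3,e_4\}$ of $T_pM$ such that each of the 2-planes $e_1\wedge e_2,\ e_1\wedge e_3,\ e_1\wedge e_4,\ e_3\wedge e_4,\ e_4\wedge e_2,\ e_2\wedge e_3$ is a critical point of this quadratic form, and, with $P_1=e_1\wedge e_2$, $P_2=e_1\wedge e_3$, $P_3=e_1\wedge e_4$, there are $\lambda_i,\mu_i\in\mathbb R$ with $$\hat R^h_LP_i=\lambda_iP_i+\mu_i\,*_hP_i,\qquad \hat R^h_L( *_hP_i)=\mu_iP_i+\lambda_i\,*_hP_i\qquad(i=1,2,3);$$ and $\hat R^h_L$ at $p$ is determined by the critical points and critical values: if $F\colon\Lambda^2(T_pM)\to\Lambda^2(T_pM)$ is any linear map that is self-adjoint for $\langle\,,\rangle_h$,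 commutes with $*_h$, satisfies the algebraic Bianchi identity, and is such that $P\mapsto\langle FP,P\rangle_h$ and $P\mapsto\langle\hat R^h_LP,P\rangle_h$ have the same critical points and the same value at each critical point, then $F=\hat R^h_L$ at $p$.
   Context: Write $\Lambda^2:=\Lambda^2(T_pM)$. $\Lambda^2$ carries the inner product $\langle v_1\wedge w_1,v_2\wedge w_2\rangle_h:=h(v_1,v_2)h(w_1,w_2)-h(v_1,w_2)h(w_1,v_2)$, and the Hodge star $*_h\colon\Lambda^2\to\Lambda^2$ of $h$ is defined by $\xi\wedge *_h\eta=\langle\xi,\eta\rangle_h\,dV$, where $dV=e_1\wedge e_2\wedge e_3\wedge e_4$ for any oriented $h$-orthonormal basis. Curvature convention: $\mathrm{Rm}_L(a,b,c,d):=g_L(\nabla_a\nabla_bc-\nabla_b\nabla_ac-\nabla_{[a,b]}c,d)$ with $\nabla$ the Levi-Civita connection of $g_L$. The operator $\hat R^h_L\colon\Lambda^2\to\Lambda^2$ is the linear map defined by $\langle\hat R^h_L(v\wedge w),x\wedge y\rangle_h=-\mathrm{Rm}_L(v,w,x,y)$ for all $v,w,x,y\in T_pM$; it is $\langle\,,\rangle_h$-self-adjoint. $(M,g_L)$ is $*_h$-Einstein (with respect to $h$) if $\hat R^h_L$ commutes with $*_h$. The trace is $\mathrm{tr}_h(\mathrm{Rm}_L)(x,y):=\sum_{i=1}^4\mathrm{Rm}_L(e_i,x,y,e_i)$ for any $h$-orthonormal basis $\{e_i\}$. A 2-plane is identified with an $h$-unit decomposable 2-vector $P\in\Lambda^2$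 (oriented 2-plane), and the quadratic forms are viewed as smooth functions on the Grassmannian of such $P$ at $p$. A linear map $F$ on $\Lambda^2$ satisfies the algebraic Bianchi identity if $\langle F(x\wedge y),z\wedge w\rangle_h+\langle F(y\wedge z),x\wedge w\rangle_h+\langle F(z\wedge x),y\wedge w\rangle_h=0$ for all $x,y,z,w\in T_pM$. *)

(* Defs.v *)
From HB Require Import structures.
From mathcomp Require Import all_boot all_order all_algebra all_fingroup.
From mathcomp Require Import all_classical all_reals all_analysis.
From mathcomp Require Import ring.

Set Implicit Arguments.
Unset Strict Implicit.
Unset Printing Implicit Defensive.

Import Order.TTheory GRing.Theory Num.Theory.
Import numFieldNormedType.Exports.

Local Open Scope classical_set_scope.
Local Open Scope ring_scope.

(* C^k and C^infinity maps on an open subset U. *)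
Fixpoint Ck (R : realType) (V W : normedModType R) (k : nat) (U : set V)
    (f : V -> W) : Prop :=
  match k with
  | 0 => forall x, U x -> {for x, continuous f}
  | k'.+1 => (forall x, U x -> differentiable f x) /\
             (forall v, Ck k' U ('D_v f))
  end.

Definition smooth_on (R : realType) (V W : normedModType R) (U : set V)
    (f : V -> W) : Prop := forall k, Ck k U f.

Record chart (R : realType) (n : nat) (M : topologicalType) := Chart {
  dom : set M;
  cod : set 'rV[R]_n;
  fwd : M -> 'rV[R]_n;
  bwd : 'rV[R]_n -> M;
  dom_open : open dom;
  cod_open : open cod;
  fwd_cod : forall p, dom p -> cod (fwd p);
  bwd_dom : forall x, cod x -> dom (bwd x);
  fwdK : forall p, dom p -> bwd (fwd p) = p;
  bwdK : forall x, cod x -> fwd (bwd x) = x;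
  fwd_continuous : forall p, dom p -> {for p, continuous fwd};
  bwd_continuous : forall x, cod x -> {for x, continuous bwd} }.

Definition transition (R : realType) (n : nat) (M : topologicalType)
    (c d : chart R n M) : 'rV[R]_n -> 'rV[R]_n := fwd d \o bwd c.

(* The orientation is carried by the atlas: all transition maps preserve the
   orientation of R^n.  [chart_at p] is a chosen chart around p. *)
Record oriented_manifold (R : realType) (n : nat) := OrientedManifold {
  carrier :> topologicalType;
  atlas : set (chart R n carrier);
  chart_at : carrier -> chart R n carrier;
  carrier_hausdorff : hausdorff_space carrier;
  carrier_second_countable : @second_countable carrier;
  chart_at_atlas : forall p, atlas (chart_at p);
  chart_at_dom : forall p, dom (chart_at p) p;
  atlas_smooth : forall c d, atlas c -> atlas d ->
    smooth_on (cod c `&` bwd c @^-1` dom d) (transition c d);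
  atlas_oriented : forall c d, atlas c -> atlas d ->
    forall x, cod c x -> dom d (bwd c x) ->
      0 < \det (jacobian (transition c d) x) }.

Arguments atlas {R n} o _.

(* The tangent space T_pM is 'rV[R]_n: a tangent vector at p is given by its
   components in the chart [chart_at p]. *)

Definition smooth_fun (R : realType) (n : nat) (M : oriented_manifold R n)
    (f : M -> R) : Prop :=
  forall c, atlas M c -> smooth_on (cod c) (f \o bwd c : 'rV[R]_n -> R).

Definition vfield (R : realType) (n : nat) (M : oriented_manifold R n) : Type :=
  M -> 'rV[R]_n.

(* Components in the chart c, at the point of coordinates x. *)
Definition vf_comp (R : realType) (n : nat) (M : oriented_manifold R n)
    (X : vfield M) (c : chart R n M) (x : 'rV[R]_n) : 'rV[R]_n :=
  let p := bwd c x in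
  'd (transition (chart_at p) c) (fwd (chart_at p) p) (X p).

Definition smooth_vf (R : realType) (n : nat) (M : oriented_manifold R n)
    (X : vfield M) : Prop :=
  forall c, atlas M c -> smooth_on (cod c) (vf_comp X c).

(* X(f), the derivative of f along X. *)
Definition vf_app (R : realType) (n : nat) (M : oriented_manifold R n)
    (X : vfield M) (f : M -> R) : M -> R :=
  fun p => 'D_(X p) (f \o bwd (chart_at p) : 'rV[R]_n -> R)
             (fwd (chart_at p) p).

(* Z = [X, Y]. *)
Definition is_lie_bracket (R : realType) (n : nat) (M : oriented_manifold R n)
    (X Y Z : vfield M) : Prop :=
  smooth_vf Z /\
  forall f, smooth_fun f -> forall p,
    vf_app Z f p = vf_app X (vf_app Y f) p - vf_app Y (vf_app X f) p.

(* A field of bilinear forms on the tangent spaces. *)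
Definition form_field (R : realType) (n : nat) (M : oriented_manifold R n)
    : Type := M -> 'rV[R]_n -> 'rV[R]_n -> R.

Record lorentzian_metric (R : realType) (M : oriented_manifold R 4)
    (g : form_field M) : Prop := LorentzianMetric {
  lor_sym : forall p u v, g p u v = g p v u;
  lor_lin : forall p u (a : R) v w, g p u (a *: v + w) = a * g p u v + g p u w;
  lor_smooth : forall X Y : vfield M, smooth_vf X -> smooth_vf Y ->
    smooth_fun (fun p => g p (X p) (Y p));
  (* signature (-,+,+,+) *)
  lor_signature : forall p, exists e : 'I_4 -> 'rV[R]_4, forall i j,
    g p (e i) (e j) = if i == j then (if i == 0 then -1 else 1) else 0 }.

(* nabla X Y stands for nabla_X Y. *)
Record levi_civita (R : realType) (n : nat) (M : oriented_manifold R n)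
    (g : form_field M) (nabla : vfield M -> vfield M -> vfield M) : Prop :=
  LeviCivita {
  lc_smooth : forall X Y, smooth_vf X -> smooth_vf Y -> smooth_vf (nabla X Y);
  lc_linear : forall (f : M -> R) X X' Y, smooth_fun f ->
    smooth_vf X -> smooth_vf X' -> smooth_vf Y -> forall p,
    nabla (fun q => f q *: X q + X' q) Y p
      = f p *: nabla X Y p + nabla X' Y p;
  lc_additive : forall X Y Y',
    smooth_vf X -> smooth_vf Y -> smooth_vf Y' -> forall p,
    nabla X (fun q => Y q + Y' q) p = nabla X Y p + nabla X Y' p;
  lc_leibniz : forall (f : M -> R) X Y, smooth_fun f ->
    smooth_vf X -> smooth_vf Y -> forall p,
    nabla X (fun q => f q *: Y q) p = vf_app X f p *: Y p + f p *: nabla X Y p;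
  lc_torsion_free : forall X Y, smooth_vf X -> smooth_vf Y ->
    is_lie_bracket X Y (fun p => nabla X Y p - nabla Y X p);
  lc_metric : forall X Y Z, smooth_vf X -> smooth_vf Y -> smooth_vf Z ->
    forall p, vf_app X (fun q => g q (Y q) (Z q)) p
      = g p (nabla X Y p) (Z p) + g p (Y p) (nabla X Z p) }.

(* Every tangent vector extends to a smooth vector field, so Rm is determined
   by its values on vector fields. *)
Definition is_curvature_tensor (R : realType) (n : nat)
    (M : oriented_manifold R n) (g : form_field M)
    (nabla : vfield M -> vfield M -> vfield M)
    (Rm : M -> 'rV[R]_n -> 'rV[R]_n -> 'rV[R]_n -> 'rV[R]_n -> R) : Prop :=
  forall A B C D AB : vfield M,
    smooth_vf A -> smooth_vf B -> smooth_vf C -> smooth_vf D ->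
    is_lie_bracket A B AB ->
    forall p, Rm p (A p) (B p) (C p) (D p)
      = g p (nabla A (nabla B C) p - nabla B (nabla A C) p - nabla AB C p)
            (D p).

(* h = g + 2 T^flat (x) T^flat. *)
Definition wick_metric (R : realType) (n : nat) (M : oriented_manifold R n)
    (g : form_field M) (T : vfield M) : form_field M :=
  fun p u v => g p u v + 2 * (g p (T p) u * g p (T p) v).

Definition orthonormal_frame (R : realType) (n : nat)
    (b : 'rV[R]_n -> 'rV[R]_n -> R) (e : 'I_n -> 'rV[R]_n) : Prop :=
  forall i j, b (e i) (e j) = (i == j)%:R.

(* Lambda^2 of 'rV[R]_4 is the space of skew-symmetric matrices, with
   v /\ w = v (x) w - w (x) v. *)
Definition skew (R : realType) : {pred 'M[R]_4} := fun A => A^T == - A.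

Fact skew_submod_closed (R : realType) : submod_closed (@skew R).
Proof.
split; first by rewrite unfold_in /skew trmx0 oppr0.
move=> a A B; rewrite !unfold_in /skew => /eqP hA /eqP hB.
by rewrite linearD linearZ /= hA hB opprD scalerN.
Qed.

HB.instance Definition _ (R : realType) :=
  GRing.isSubmodClosed.Build R 'M[R]_4 (@skew R) (@skew_submod_closed R).

Record bivector (R : realType) :=
  Bivector { bivector_val :> 'M[R]_4; _ : bivector_val \in @skew R }.

HB.instance Definition _ (R : realType) :=
  [isSub for @bivector_val R].
HB.instance Definition _ (R : realType) := [Choice of bivector R by <:].
HB.instance Definition _ (R : realType) :=
  [SubChoice_isSubLmodule of bivector R by <:].

Fact wedge_subproof (R : realType) (v w : 'rV[R]_4) :
  v^T *m w - w^T *m v \in @skew R.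
Proof. by rewrite unfold_in /skew linearB /= !trmx_mul !trmxK opprB. Qed.

Definition wedge (R : realType) (v w : 'rV[R]_4) : bivector R :=
  Bivector (wedge_subproof v w).

(* The inner product induced by b on Lambda^2, i.e. half of the full
   contraction of two skew tensors; see [ip2_wedge]. *)
Definition ip2 (R : realType) (b : 'rV[R]_4 -> 'rV[R]_4 -> R)
    (xi eta : bivector R) : R :=
  2^-1 * \sum_i \sum_j \sum_k \sum_l
    bivector_val xi i j * bivector_val eta k l
      * (b (delta_mx 0 i) (delta_mx 0 k) * b (delta_mx 0 j) (delta_mx 0 l)).

Fact ip2_wedge (R : realType) (b : 'rV[R]_4 -> 'rV[R]_4 -> R)
    (bsym : forall u v, b u v = b v u)
    (blin : forall u (a : R) v w, b u (a *: v + w) = a * b u v + b u w)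
    (v1 w1 v2 w2 : 'rV[R]_4) :
  ip2 b (wedge v1 w1) (wedge v2 w2) = b v1 v2 * b w1 w2 - b v1 w2 * b w1 v2.
Proof.
have b0 u : b u 0 = 0.
  by have := blin u (-1) 0 0; rewrite scaleN1r oppr0 addr0 mulN1r addNr.
have bsum u v : b u v = \sum_j v 0 j * b u (delta_mx 0 j).
  have bs (s : seq 'I_4) : b u (\sum_(j <- s) v 0 j *: delta_mx 0 j)
      = \sum_(j <- s) v 0 j * b u (delta_mx 0 j).
    elim: s => [|j s IH]; first by rewrite !big_nil b0.
    by rewrite !big_cons blin IH.
  by rewrite {1}(row_sum_delta v) bs.
have bb u v : b u v
    = \sum_i \sum_j u 0 i * v 0 j * b (delta_mx 0 i) (delta_mx 0 j).
  rewrite bsym bsum; apply: eq_bigr => i _.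
  rewrite bsym bsum big_distrr /=; apply: eq_bigr => j _.
  by rewrite mulrA.
have prod u v u' v' : b u v * b u' v' =
    \sum_i \sum_j \sum_k \sum_l (u 0 i * u' 0 j) * (v 0 k * v' 0 l)
     * (b (delta_mx 0 i) (delta_mx 0 k) * b (delta_mx 0 j) (delta_mx 0 l)).
  rewrite (bb u v) (bb u' v') big_distrlr /=.
  apply: eq_bigr => i _; apply: eq_bigr => j _.
  rewrite big_distrlr /=.
  apply: eq_bigr => k _; apply: eq_bigr => l _.
  ring.
have -> : b v1 v2 * b w1 w2 - b v1 w2 * b w1 v2 =
    2^-1 * (b v1 v2 * b w1 w2 - b v1 w2 * b w1 v2
            - b w1 v2 * b v1 w2 + b w1 w2 * b v1 v2) by field.
rewrite !prod /ip2 -!sumrB -big_split /=; congr (_ * _).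
apply: eq_bigr => i _; rewrite -!sumrB -big_split /=.
apply: eq_bigr => j _; rewrite -!sumrB -big_split /=.
apply: eq_bigr => k _; rewrite -!sumrB -big_split /=.
apply: eq_bigr => l _; rewrite !mxE !big_ord1 !mxE.
ring.
Qed.

(* xi /\ zeta in Lambda^4, identified with R through the basis
   d_1 /\ d_2 /\ d_3 /\ d_4 given by the standard basis of 'rV[R]_4; see
   [wedge22_wedge]. *)
Definition wedge22 (R : realType) (xi zeta : bivector R) : R :=
  4^-1 * \sum_(s : 'S_4) (-1) ^+ s
    * (bivector_val xi (s 0) (s 1) * bivector_val zeta (s 2) (s 3)).

Fact wedge22_wedge (R : realType) (v w x y : 'rV[R]_4) :
  wedge22 (wedge v w) (wedge x y) = \det (\matrix_(i < 4) [:: v; w; x; y]`_i).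
Proof.
pose t (s : 'S_4) : R := v 0 (s 0) * w 0 (s 1) * (x 0 (s 2) * y 0 (s 3)).
pose a : 'S_4 := tperm 0 1; pose b : 'S_4 := tperm 2 3.
have detE : \det (\matrix_(i < 4) [:: v; w; x; y]`_i)
    = \sum_(s : 'S_4) (-1) ^+ s * t s.
  apply: eq_bigr => s _; congr (_ * _).
  rewrite !big_ord_recl big_ord0 !mxE /= /t mulr1 !mulrA.
  by congr (_ * w 0 (s _) * x 0 (s _) * y 0 (s _)); apply: val_inj.
have shift (c : 'S_4) : odd_perm c ->
    forall F : 'S_4 -> R, \sum_(s : 'S_4) (-1) ^+ s * F (c * s)%g
    = - \sum_(s : 'S_4) (-1) ^+ s * F s.
  move=> oc F; rewrite [in RHS](reindex_inj (mulgI c)) /= -sumrN.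
  apply: eq_bigr => s _; rewrite odd_permM oc.
  by case: (odd_perm s); rewrite /= ?expr1 ?expr0 ?mulN1r ?mul1r ?opprK.
have oa : odd_perm a by rewrite odd_tperm.
have ob : odd_perm b by rewrite odd_tperm.
rewrite detE /wedge22.
have -> : \sum_(s : 'S_4) (-1) ^+ s * (bivector_val (wedge v w) (s 0) (s 1)
      * bivector_val (wedge x y) (s 2) (s 3))
   = \sum_(s : 'S_4) (-1) ^+ s * (t s - t (a * s)%g - t (b * s)%g
                                  + t (a * (b * s))%g).
  apply: eq_bigr => s _; congr (_ * _).
  rewrite /t !permM /a /b !tpermL !tpermR.
  rewrite ![tperm 0 1 2]tpermD // ![tperm 0 1 3]tpermD //.
  rewrite ![tperm 2 3 0]tpermD // ![tperm 2 3 1]tpermD //.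
  rewrite !(tpermL, tpermR) !mxE !big_ord1 !mxE; ring.
under eq_bigr do rewrite mulrDr !mulrBr.
rewrite big_split !sumrB /= (shift a oa t) (shift b ob t).
rewrite (shift b ob (fun s => t (a * s)%g)) (shift a oa t).
set S := \sum_(s : 'S_4) _; by field.
Qed.

(* xi /\ *eta = <xi, eta> dV; the coordinate of dV = e_1 /\ e_2 /\ e_3 /\ e_4
   in Lambda^4 is the determinant of the e_i, which is positive when the basis
   is oriented. *)
Definition is_hodge_star (R : realType) (b : 'rV[R]_4 -> 'rV[R]_4 -> R)
    (star : bivector R -> bivector R) : Prop :=
  forall e : 'I_4 -> 'rV[R]_4,
  orthonormal_frame b e -> 0 < \det (\matrix_i e i) ->
  forall xi eta, wedge22 xi (star eta) = ip2 b xi eta * \det (\matrix_i e i).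

Definition is_curvature_operator (R : realType)
    (b : 'rV[R]_4 -> 'rV[R]_4 -> R)
    (Rmp : 'rV[R]_4 -> 'rV[R]_4 -> 'rV[R]_4 -> 'rV[R]_4 -> R)
    (Rhat : bivector R -> bivector R) : Prop :=
  forall v w x y, ip2 b (Rhat (wedge v w)) (wedge x y) = - Rmp v w x y.

Definition self_adjoint (R : realType) (b : 'rV[R]_4 -> 'rV[R]_4 -> R)
    (F : bivector R -> bivector R) : Prop :=
  forall xi eta, ip2 b (F xi) eta = ip2 b xi (F eta).

Definition algebraic_bianchi (R : realType) (b : 'rV[R]_4 -> 'rV[R]_4 -> R)
    (F : bivector R -> bivector R) : Prop :=
  forall x y z w,
    ip2 b (F (wedge x y)) (wedge z w) + ip2 b (F (wedge y z)) (wedge x w)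
      + ip2 b (F (wedge z x)) (wedge y w) = 0.

(* Oriented 2-planes. *)
Definition grassmannian (R : realType) (b : 'rV[R]_4 -> 'rV[R]_4 -> R)
    : set (bivector R) :=
  [set P | (exists v w, P = wedge v w) /\ ip2 b P P = 1].

Definition quad (R : realType) (b : 'rV[R]_4 -> 'rV[R]_4 -> R)
    (F : bivector R -> bivector R) (P : bivector R) : R := ip2 b (F P) P.

(* P is a critical point of the restriction of [quad b F] to the Grassmannian:
   its differential vanishes on the velocities of all smooth curves of the
   Grassmannian through P. *)
Definition critical_point (R : realType) (b : 'rV[R]_4 -> 'rV[R]_4 -> R)
    (F : bivector R -> bivector R) (P : bivector R) : Prop :=
  grassmannian b P /\
  forall c : R -> bivector R,
    smooth_on [set: R] (fun t => bivector_val (c t)) ->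
    (forall t, grassmannian b (c t)) -> c 0 = P ->
    is_derive (0 : R) (1 : R) (fun t => quad b F (c t)) 0.

Definition star_einstein (R : realType) (M : oriented_manifold R 4)
    (star Rhat : M -> bivector R -> bivector R) : Prop :=
  forall p xi, Rhat p (star p xi) = star p (Rhat p xi).

(* Main.v *)
Require Import Defs.
From HB Require Import structures.
From mathcomp Require Import all_boot all_order all_algebra all_fingroup.
From mathcomp Require Import all_classical all_reals all_analysis.
From mathcomp Require Import ring lra.

(** Everything in the statement except the smoothness of f happens in one tangent
    space, once the curvature operator is known to satisfy the Bianchi identity.

    The Bianchi identity for the given curvature tensor comes from the Jacobi
    identity for Lie brackets ([first_bianchi]); as the tensor is given by its
    values on vector fields, this needs bump functions to extend tangent vectors
    and to separate them by functions. Together with the antisymmetries built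
    into the operator it yields pair symmetry, that is, self-adjointness.

    The form h is positive definite: a Lorentzian reflection carries a frame for
    g to one whose first vector is T up to sign ([wick_frame]). In an
    h-orthonormal frame the star exchanges the planes 01, 02, 03 with 23, 31, 12,
    up to a common sign. For part (a), an operator commutes with the star exactly
    when its matrix is invariant under this exchange, and the equations for this
    are equivalent, by linear algebra, to the Ricci contraction being a multiple
    of the identity ([commute_iff_ricci]). The multiple is the contraction
    evaluated at T, and it is smooth because a trace is a rational function of
    the components in a smooth local basis ([smooth_trace]).

    For part (b), the matrix of a commuting operator has two equal diagonal
    blocks A and two equal off-diagonal blocks B, all symmetric 3 x 3 matrices.
    Both become diagonal in a frame which maximises A_11 + 2 A_22 + 3 A_33 over
    the compact set of orthonormal frames: rotations fixing e_0 mix the planes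
    through e_0 among themselves, rotations moving e_0 mix them with the dual
    planes, and the first variation for the six coordinate rotations gives the
    vanishing of the off-diagonal entries of A and of B ([maximal_frame_normal]).
    A unit decomposable P with F P in the span of P and star P is critical,
    because <Q, Q> = 1 and <star Q, Q> = 0 on the Grassmannian
    ([critical_of_eigen]).

    For uniqueness ([normal_form_unique]), critical coordinate planes force F into
    the same normal form, with the same diagonal of A. The diagonal entries of B
    have sum zero by the Bianchi identity, and their differences are read off from
    the values at further critical planes, which combine the self-dual part of one
    coordinate plane with the anti-self-dual part of another ([mixed_plane]). *)

Set Implicit Arguments.
Unset Strict Implicit.
Unset Printing Implicit Defensive.

Import Order.TTheory GRing.Theory Num.Theory.
Import numFieldNormedType.Exports.

Local Open Scope classical_set_scope.
Local Open Scope ring_scope.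

(** * Smooth functions on open sets *)

Section Calculus.
Variable R : realType.
Implicit Types V W : normedModType R.

Lemma differentiable_near V W (f g : V -> W) (x : V) :
  (\forall y \near x, f y = g y) -> differentiable f x -> differentiable g x.
Proof.
move=> fg df.
suff du : differentiable (g - f) x.
  have -> : g = f + (g - f) by rewrite addrC subrK.
  exact: differentiableD.
have near0 : (g - f) \o shift x = cst ((g - f) x) + (0 : V -> W) +o_ 0 id.
  apply/eqaddoP => _ /posnumP[e].
  have := fg; rewrite (near_shift 0) /= subr0.
  apply: filterS => h /= E.
  rewrite !fctE /= -E subrr (nbhs_singleton fg) subrr addr0 subrr normr0.
  exact: mulr_ge0.
apply/diff_locallyP; rewrite (diff_unique _ near0).
  split; last by [].
  by move=> y; apply: cst_continuous.
by move=> y; apply: cst_continuous.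
Qed.

Lemma open_near V (U : set V) x : open U -> U x -> \forall y \near x, U y.
Proof. by move=> oU Ux; exact: open_nbhs_nbhs. Qed.

(** Equality on an open set is equality near each of its points, so all the
    directional derivatives agree there too. *)
Lemma Ck_ext V W k (U : set V) (f g : V -> W) : open U ->
  (forall x, U x -> f x = g x) -> Ck k U f -> Ck k U g.
Proof.
move=> oU; elim: k f g => [|k IH] f g fg.
  move=> fc x Ux; have N : \forall y \near x, f y = g y.
    by apply: filterS (open_near oU Ux) => y; exact: fg.
  change (g @ x --> g x); have <- := fg x Ux.
  exact: (cvg_trans (near_eq_cvg N)) (fc _ Ux).
move=> [df Cf]; have N x : U x -> \forall y \near x, f y = g y.
  by move=> Ux; apply: filterS (open_near oU Ux) => y; exact: fg.
split=> [x Ux|v]; first exact: differentiable_near (N x Ux) (df x Ux).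
by apply: IH (Cf v) => x /N; exact: near_eq_derive.
Qed.

Lemma Ck_sub V W k (U U' : set V) (f : V -> W) : U' `<=` U ->
  Ck k U f -> Ck k U' f.
Proof.
move=> sU; elim: k f => [|k IH] f; first by move=> C x /sU Ux; exact: (C x Ux).
by move=> [df Cf]; split=> [x /sU Ux|v]; [exact: (df x Ux)|exact: (IH _ (Cf v))].
Qed.

(** Every clause of [Ck] speaks of one point of [U] at a time, so being C^k can
    be tested with a different set around each point. *)
Lemma Ck_local V W k (U : set V) (f : V -> W) :
  (forall x, U x -> exists2 D : set V, D x & Ck k D f) -> Ck k U f.
Proof.
elim: k f => [|k IH] f H.
  by move=> x Ux; have [D Dx Cf] := H x Ux; exact: (Cf x Dx).
split=> [x Ux|v]; first by have [D Dx [df _]] := H x Ux; exact: df.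
by apply: (IH ('D_v f)) => x Ux; have [D Dx [_ Cf]] := H x Ux; exists D => //; exact: (Cf v).
Qed.

Lemma CkW V W k (U : set V) (f : V -> W) : Ck k.+1 U f -> Ck k U f.
Proof.
elim: k f => [|k IH] f.
  by move=> [df _] x Ux; exact: differentiable_continuous (df x Ux).
by move=> [df Cf]; split=> // v; exact: (IH _ (Cf v)).
Qed.

Lemma Ck_diff V W k (U : set V) (f : V -> W) x : Ck k.+1 U f -> U x ->
  differentiable f x.
Proof. by case=> df _; exact: df. Qed.

Lemma Ck_cst V W k (U : set V) (a : W) : Ck k U (fun=> a).
Proof.
elim: k a => [|k IH] a; first by move=> x _; exact: cst_continuous.
split=> [x _|v]; first exact: differentiable_cst.
rewrite (_ : 'D_v _ = fun=> 0); first exact: (IH 0).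
by apply/funext => x; exact: derive_cst.
Qed.

Lemma CkD V W k (U : set V) (f g : V -> W) : open U ->
  Ck k U f -> Ck k U g -> Ck k U (fun x => f x + g x).
Proof.
move=> oU; elim: k f g => [|k IH] f g.
  by move=> Cf Cg x Ux; exact: continuousD (Cf x Ux) (Cg x Ux).
move=> [df Cf] [dg Cg]; split=> [x Ux|v].
  exact: differentiableD (df x Ux) (dg x Ux).
apply: Ck_ext oU _ (IH _ _ (Cf v) (Cg v)) => x Ux.
by rewrite [RHS]deriveD//; apply: diff_derivable; auto.
Qed.

(** A continuous linear map commutes with directional derivatives. *)
Lemma Ck_lin V W W' k (U : set V) (L : {linear W -> W'}) (f : V -> W) : open U ->
  continuous L -> Ck k U f -> Ck k U (fun x => L (f x)).
Proof.
move=> oU cL; elim: k f => [|k IH] f.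
  move=> Cf x Ux; apply: (@continuous_comp _ _ _ f L); [exact: Cf|exact: cL].
move=> [df Cf].
have dL y : differentiable L y by exact: linear_differentiable.
have dLf x : U x -> differentiable (L \o f) x.
  by move=> Ux; apply: differentiable_comp; [exact: df|exact: dL].
split=> [x Ux|v]; first exact: dLf.
apply: Ck_ext oU _ (IH _ (Cf v)) => x Ux.
rewrite [RHS](deriveE _ (dLf x Ux)) diff_comp//; last exact: df.
by rewrite diff_lin//= deriveE//; exact: df.
Qed.

Lemma CkZ V W k (U : set V) (a : R) (f : V -> W) : open U ->
  Ck k U f -> Ck k U (fun x => a *: f x).
Proof.
move=> oU; have -> : (fun x => a *: f x) = (fun x => ( *:%R a : {linear W -> W}) (f x)) by [].
by apply: Ck_lin => // y; exact: scaler_continuous.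
Qed.

Lemma CkZl V W k (U : set V) (f : V -> R) (w : W) : open U ->
  Ck k U f -> Ck k U (fun x => f x *: w).
Proof.
move=> oU.
have lin : linear (fun a : R => a *: w) by move=> a b c; rewrite scalerDl scalerA.
pose L : {linear R -> W} := HB.pack (fun a : R => a *: w) (GRing.isLinear.Build _ _ _ _ _ lin).
apply: (@Ck_lin _ R W k U L) => //.
exact: scalel_continuous.
Qed.

Lemma CkN V W k (U : set V) (f : V -> W) : open U ->
  Ck k U f -> Ck k U (fun x => - f x).
Proof.
by move=> oU /(CkZ (-1) oU); apply: Ck_ext => // x _; rewrite scaleN1r.
Qed.

Lemma CkB V W k (U : set V) (f g : V -> W) : open U ->
  Ck k U f -> Ck k U g -> Ck k U (fun x => f x - g x).
Proof. by move=> oU Cf Cg; apply: CkD => //; apply: CkN. Qed.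

Lemma Ck_sum V W k (U : set V) (I : Type) (s : seq I) (P : pred I) (f : I -> V -> W) : open U ->
  (forall i, P i -> Ck k U (f i)) -> Ck k U (fun x => \sum_(i <- s | P i) f i x).
Proof.
move=> oU H; elim: s => [|i s IH].
  by rewrite (_ : (fun _ => _) = fun=> 0); [exact: Ck_cst|apply/funext => x; rewrite big_nil].
case Pi: (P i); last first.
  by rewrite (_ : (fun _ => _) = (fun x => \sum_(j <- s | P j) f j x))//;
    apply/funext => x; rewrite big_cons Pi.
rewrite (_ : (fun _ => _) = (fun x => f i x + \sum_(j <- s | P j) f j x)).
  by apply: CkD => //; exact: H.
by apply/funext => x; rewrite big_cons Pi.
Qed.

Lemma CkM V k (U : set V) (f g : V -> R) : open U ->
  Ck k U f -> Ck k U g -> Ck k U (fun x => f x * g x).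
Proof.
move=> oU; elim: k f g => [|k IH] f g.
  by move=> Cf Cg x Ux; exact: continuousM (Cf x Ux) (Cg x Ux).
move=> Cf Cg; have [df Df] := Cf; have [dg Dg] := Cg.
split=> [x Ux|v]; first exact: differentiableM (df x Ux) (dg x Ux).
have C := CkD oU (IH _ _ (CkW Cf) (Dg v)) (IH _ _ (CkW Cg) (Df v)).
apply: Ck_ext oU _ C => x Ux.
by rewrite [RHS]deriveM//; apply: diff_derivable; auto.
Qed.

Lemma Ck_prod V k (U : set V) (I : Type) (s : seq I) (P : pred I) (f : I -> V -> R) : open U ->
  (forall i, P i -> Ck k U (f i)) -> Ck k U (fun x => \prod_(i <- s | P i) f i x).
Proof.
move=> oU H; elim: s => [|i s IH].
  by rewrite (_ : (fun _ => _) = fun=> 1); [exact: Ck_cst|apply/funext => x; rewrite big_nil].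
case Pi: (P i); last first.
  by rewrite (_ : (fun _ => _) = (fun x => \prod_(j <- s | P j) f j x))//;
    apply/funext => x; rewrite big_cons Pi.
rewrite (_ : (fun _ => _) = (fun x => f i x * \prod_(j <- s | P j) f j x)).
  by apply: CkM => //; exact: H.
by apply/funext => x; rewrite big_cons Pi.
Qed.

Lemma CkV V k (U : set V) (f : V -> R) : open U -> (forall x, U x -> f x != 0) ->
  Ck k U f -> Ck k U (fun x => (f x)^-1).
Proof.
move=> oU nz; elim: k f nz => [|k IH] f nz.
  by move=> Cf x Ux; apply: continuousV; [exact: nz|exact: Cf].
move=> Cf; have [df Df] := Cf.
split=> [x Ux|v]; first exact: differentiableV (df x Ux) (nz x Ux).
have C1 := IH _ nz (CkW Cf).
have C := CkN oU (CkM oU (CkM oU C1 C1) (Df v)).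
apply: Ck_ext oU _ C => x Ux.
rewrite [RHS]deriveV//; [|exact: nz|by apply: diff_derivable; auto].
by rewrite -exprVn expr2 scaleNr.
Qed.

Lemma Ck_coord V k n (U : set V) (f : V -> 'rV[R]_n) : open U ->
  Ck k U f <-> forall i, Ck k U (fun x => f x 0 i).
Proof.
move=> oU; split=> [C i|C].
  have lin : linear (fun w : 'rV[R]_n => w 0 i) by move=> a b c; rewrite !mxE.
  pose L : {linear 'rV[R]_n -> R} := HB.pack (fun w : 'rV[R]_n => w 0 i) (GRing.isLinear.Build _ _ _ _ _ lin).
  by apply: (@Ck_lin _ _ R k U L) => //; exact: coord_continuous.
have -> : f = (fun x => \sum_i f x 0 i *: delta_mx 0 i).
  by apply/funext => x; exact: row_sum_delta.
by apply: Ck_sum => // i _; exact: CkZl.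
Qed.

Lemma Ck_id V k (U : set V) : Ck k U (fun x : V => x).
Proof.
case: k => [|k]; first by move=> x _; exact: cvg_id.
split=> [x _|v]; first exact: (@ex_diff _ _ _ _ _ id).
rewrite (_ : 'D_v _ = fun=> v); first exact: Ck_cst.
by apply/funext => x; exact: derive_id.
Qed.

Lemma Ck_proj k n (U : set 'rV[R]_n) i : open U -> Ck k U (fun x : 'rV[R]_n => x 0 i).
Proof. by move=> oU; exact: (Ck_coord k _ oU).1 (@Ck_id _ k U) i. Qed.

Lemma diff_coord_sum n W (f : 'rV[R]_n -> W) (y v : 'rV[R]_n) :
  differentiable f y -> 'd f y v = \sum_i v 0 i *: 'D_(delta_mx 0 i) f y.
Proof.
move=> df; rewrite {1}(row_sum_delta v) linear_sum; apply: eq_bigr => i _.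
by rewrite linearZ deriveE.
Qed.

(** The derivative of [f o t] along [v] is the sum over [i] of [D_v t_i] times
    [(D_i f) o t]: a sum of products of functions covered by the induction. *)
Lemma Ck_comp V k n (U : set V) (D : set 'rV[R]_n) (t : V -> 'rV[R]_n) (f : 'rV[R]_n -> R) :
  open U -> (forall x, U x -> D (t x)) -> Ck k D f -> Ck k U t -> Ck k U (fun x => f (t x)).
Proof.
move=> oU UD; elim: k f => [|k IH] f Cf Ct.
  move=> x Ux; apply: (@continuous_comp _ _ _ t f); first exact: Ct.
  exact/Cf/UD.
have [df Df] := Cf; have [dt Dt] := Ct.
have dft x : U x -> differentiable (f \o t) x.
  by move=> Ux; apply: differentiable_comp; [exact: dt|exact/df/UD].
split=> [x Ux|v]; first exact: dft.
have C : Ck k U (fun x => \sum_i ('D_v t x) 0 i * 'D_(delta_mx 0 i) f (t x)).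
  apply: Ck_sum => // i _; apply: CkM => //.
    exact: (Ck_coord k ('D_v t) oU).1 (Dt v) i.
  by apply: (IH ('D_(delta_mx 0 i) f)); [exact: Df|exact: CkW].
apply: Ck_ext oU _ C => x Ux.
rewrite [RHS](deriveE _ (dft x Ux)) diff_comp//; [|exact: dt|exact/df/UD].
rewrite /= diff_coord_sum; last exact/df/UD.
by rewrite -deriveE//; exact: dt.
Qed.

Lemma Ck_comp_vec V k n m (U : set V) (D : set 'rV[R]_n) (t : V -> 'rV[R]_n) (f : 'rV[R]_n -> 'rV[R]_m) :
  open U -> open D -> (forall x, U x -> D (t x)) -> Ck k D f -> Ck k U t -> Ck k U (fun x => f (t x)).
Proof.
move=> oU oD UD Cf Ct; apply/(Ck_coord _ _ oU) => i.
apply: (@Ck_comp _ _ _ U D t (fun y => f y 0 i)) => //.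
exact: (Ck_coord k f oD).1 Cf i.
Qed.

Lemma Ck_comp1 V k (U : set V) (t : V -> R) (f : R -> R) :
  open U -> Ck k setT f -> Ck k U t -> Ck k U (fun x => f (t x)).
Proof.
move=> oU; elim: k f => [|k IH] f Cf Ct.
  move=> x Ux; apply: (@continuous_comp _ _ _ t f); first exact: Ct.
  exact/Cf.
have [df Df] := Cf; have [dt Dt] := Ct.
have dft x : U x -> differentiable (f \o t) x.
  by move=> Ux; apply: differentiable_comp; [exact: dt|exact/df].
split=> [x Ux|v]; first exact: dft.
have C : Ck k U (fun x => 'D_v t x * 'D_1 f (t x)).
  by exact: (CkM oU (Dt v) (IH _ (Df 1) (CkW Ct))).
apply: Ck_ext oU _ C => x Ux.
rewrite [RHS](deriveE _ (dft x Ux)) diff_comp//; [|exact: dt|exact/df].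
rewrite /= diff1E; last exact: df.
by rewrite derive1E -deriveE//; exact: dt.
Qed.

End Calculus.

(** * Bump functions *)

Section Bump.
Variable R : realType.

(** The flat function [exp (- 1 / t)], multiplied by a polynomial in [1 / t]: the
    polynomial is there because this family is closed under differentiation. *)
Definition flat_exp (p : {poly R}) (t : R) : R :=
  if 0 < t then p.[t^-1] * expR (- t^-1) else 0.

Lemma poly_growth (p : {poly R}) :
  exists2 C : R, 0 <= C & forall s : R, 1 <= s -> `|p.[s]| <= C * s ^+ size p.
Proof.
exists (\sum_(i < size p) `|p`_i|); first exact: sumr_ge0.
move=> s s1; rewrite horner_coef mulr_suml (le_trans (ler_norm_sum _ _ _))//.
apply: ler_sum => i _; rewrite normrM ler_wpM2l// ger0_norm ?exprn_ge0 ?(le_trans ler01)//.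
by rewrite ler_weXn2l// ltnW.
Qed.

(** With [s = 1 / t], the polynomial grows at most like [s ^ n], while [exp s] is
    at least [s ^ (n + 1) / (n + 1)!]. *)
Lemma flat_exp_linear_bound (p : {poly R}) :
  exists2 C : R, 0 <= C & forall t : R, 0 < t <= 1 -> `|flat_exp p t| <= C * t.
Proof.
have [C C0 HC] := poly_growth p.
exists (C * (size p).+1`!%:R); first by rewrite mulr_ge0.
move=> t /andP[t0 t1]; rewrite /flat_exp t0.
have s1 : 1 <= t^-1 by rewrite invf_ge1.
have s0 : 0 < t^-1 by rewrite invr_gt0.
rewrite normrM (gtr0_norm (expR_gt0 _)) expRN ler_pdivrMr ?expR_gt0//.
apply: (le_trans (HC _ s1)).
rewrite -!mulrA ler_wpM2l//.
have /(le_trans _) H := expR_ge1Dxn (size p) (ltW s0).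
have {}H : t^-1 ^+ (size p).+1 / (size p).+1`!%:R <= expR t^-1.
  by apply: H; rewrite lerDr.
rewrite ler_pdivrMr ?ltr0n ?fact_gt0// in H.
have -> : t^-1 ^+ size p = t * t^-1 ^+ (size p).+1.
  by rewrite exprS mulrA divff ?mul1r// gt_eqF.
by rewrite mulrCA ler_pM2l// mulrC.
Qed.

(** One more factor [t] comes from writing [p (1 / t) = t * ('X * p) (1 / t)]; a
    quadratic bound is what makes the derivative at [0] vanish. *)
Lemma flat_exp_sq_bound (p : {poly R}) :
  exists2 C : R, 0 <= C & forall t : R, `|t| <= 1 -> `|flat_exp p t| <= C * t ^+ 2.
Proof.
have [C C0 HC] := flat_exp_linear_bound ('X * p).
exists C => // t t1; have [t0|t0] := ltP 0 t; last first.
  by rewrite /flat_exp ltNge t0 normr0 mulr_ge0// sqr_ge0.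
have := HC t; rewrite t0 -(gtr0_norm t0) t1 => /(_ isT).
rewrite gtr0_norm// /flat_exp t0 hornerM hornerX -mulrA normrM gtr0_norm ?invr_gt0//.
by rewrite ler_pdivrMl// mulrCA -expr2.
Qed.

Lemma is_derive_flat0 (f : R -> R) (C : R) : f 0 = 0 ->
  (forall t, `|t| <= 1 -> `|f t| <= C * t ^+ 2) -> is_derive (0 : R) (1 : R) f 0.
Proof.
move=> f0 H.
have L : h^-1 *: (f (h *: 1 + 0) - f 0) @[h --> 0^'] --> (0 : R).
  apply/cvgrPdist_le => e e0; near=> h.
  have h0 : h != 0 by near: h; exact: nbhs_dnbhs_neq.
  rewrite sub0r normrN f0 subr0 addr0 /GRing.scale /= mulr1 normrM normfV.
  rewrite ler_pdivrMl ?normr_gt0//.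
  have h1 : `|h| <= 1 by near: h; exact: dnbhs0_le.
  apply: (le_trans (H _ h1)).
  have -> : h ^+ 2 = `|h| * `|h| by rewrite -normrM -expr2 ger0_norm ?sqr_ge0.
  rewrite mulrCA ler_wpM2l//.
  have hC : `|h| <= e / (`|C| + 1).
    by near: h; apply: dnbhs0_le; rewrite divr_gt0// ltr_wpDl.
  rewrite (le_trans (ler_wpM2r _ (ler_norm C)))//.
  apply: (@le_trans _ _ ((`|C| + 1) * `|h|)); first by rewrite ler_wpM2r// lerDl.
  by rewrite -ler_pdivlMl ?ltr_wpDl// mulrC.
split; first by apply/cvg_ex; exists 0.
by apply/cvg_lim.
Unshelve. all: by end_near. Qed.

(** For [t > 0] this is the product rule, [1 / t] having derivative [- 1 / t ^ 2];
    at [0] both one-sided derivatives vanish by the quadratic bound. *)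
Lemma is_derive_flat_exp (p : {poly R}) (t : R) :
  is_derive t (1 : R) (flat_exp p) (flat_exp ('X^2 * (p - p^`())) t).
Proof.
have [t0|t0|->] := ltgtP t 0.
- rewrite [X in is_derive _ _ _ X]/flat_exp ltNge ltW//=.
  apply: (@near_eq_is_derive _ _ _ (cst 0)).
  by near=> s; rewrite /flat_exp /= ltNge ltW//; near: s; exact: lt_nbhsl.
- rewrite [X in is_derive _ _ _ X]/flat_exp t0.
  have tn0 : t != 0 by rewrite gt_eqF.
  apply: (@near_eq_is_derive _ _ _ (fun s : R => p.[s^-1] * expR (- s^-1) : R)).
    by near=> s; rewrite /flat_exp ifT//; near: s; exact: lt_nbhsr.
  have dinv : is_derive t (1 : R) (GRing.inv : R -> R) (- t ^- 2).
    have := @is_deriveV R id t 1 1 tn0 (is_derive_id _ _).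
    by rewrite /GRing.scale /= mulr1.
  have d1 := @is_derive1_comp R (horner p) GRing.inv t _ _ (is_derive_poly p t^-1) dinv.
  have d2 := @is_derive1_comp R expR (fun s => - s^-1) t _ _
    (is_derive_expR (- t^-1)) (is_deriveN dinv).
  have D := is_deriveM d1 d2; refine (is_derive_eq D _).
  rewrite /= hornerM hornerXn hornerD hornerN -exprVn /GRing.scale /=.
  set e := expR _; ring.
- have [C C0 HC] := flat_exp_sq_bound p.
  rewrite [X in is_derive _ _ _ X]/flat_exp ltxx.
  by apply: is_derive_flat0 HC; rewrite /flat_exp ltxx.
Unshelve. all: by end_near. Qed.

Lemma derive_scale (f : R -> R) (t v : R) : differentiable f t ->
  'D_v f t = v * 'D_1 f t.
Proof.
by move=> df; rewrite !deriveE// -{1}[v]mulr1 -[v * 1]/(v *: (1 : R)) linearZ.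
Qed.

Lemma Ck_flat_exp k (p : {poly R}) : Ck k setT (flat_exp p).
Proof.
have df q t : differentiable (flat_exp q) t.
  apply/derivable1_diffP; by have [] := is_derive_flat_exp q t.
elim: k p => [|k IH] p.
  by move=> t _; exact: differentiable_continuous.
split=> [t _|v]; first exact: df.
have -> : 'D_v (flat_exp p) = (fun t => v *: flat_exp ('X^2 * (p - p^`())) t).
  apply/funext => t; rewrite derive_scale//.
  by have [_ ->] := is_derive_flat_exp p t.
apply: CkZ; [exact: openT|exact: IH].
Qed.

Lemma bump_ball n (a : 'rV[R]_n) (r : R) : 0 < r ->
  exists b : 'rV[R]_n -> R, [/\ smooth_on setT b, b a != 0 &
    forall x, b x != 0 -> `|x - a| <= r].
Proof.
move=> r0.
(* The sum of squares is smooth and dominates the square of the sup norm. *)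
pose s (x : 'rV[R]_n) := r ^+ 2 - \sum_i (x 0 i - a 0 i) ^+ 2.
exists (fun x => flat_exp 1 (s x)); split.
- move=> k; apply: Ck_comp1; [exact: openT|exact: Ck_flat_exp|].
  apply: CkB; [exact: openT|exact: Ck_cst|].
  apply: Ck_sum; first exact: openT.
  move=> i _.
  have C : Ck k [set: 'rV[R]_n] (fun x => x 0 i - a 0 i).
    apply: CkB; [exact: openT| |exact: Ck_cst].
    exact: Ck_proj (@openT _).
  have := CkM (@openT _) C C.
  by apply: Ck_ext => //; exact: openT.
- rewrite /s big1; last by move=> i _; rewrite subrr expr0n.
  rewrite /flat_exp subr0 exprn_gt0// hornerE mul1r.
  by rewrite gt_eqF// expR_gt0.
- move=> x; rewrite /flat_exp; case: ifP; rewrite ?eqxx//.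
  rewrite subr_gt0 => H _.
  have K i : `|x 0 i - a 0 i| <= r.
    rewrite -ler_sqr ?nnegrE ?normr_ge0 ?(ltW r0)// real_normK ?num_real//.
    apply: le_trans (ltW H).
    by rewrite (bigD1 i)//= lerDl sumr_ge0// => j _; exact: sqr_ge0.
  rewrite /Num.Def.normr /= mx_normrE; apply: bigmax_le; first exact: ltW.
  by move=> [i j] _; rewrite !mxE /= ord1.
Qed.

(** The condition [b a != 0] suits both uses: vectors are extended after division
    by [b a], and test functions are [b] times a coordinate vanishing at [a]. *)
Lemma bump_open n (a : 'rV[R]_n) (U : set 'rV[R]_n) : open U -> U a ->
  exists b : 'rV[R]_n -> R, exists K : set 'rV[R]_n,
    [/\ smooth_on setT b, b a != 0, compact K, K `<=` U &
        forall x, ~ K x -> b x = 0].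
Proof.
move=> oU Ua.
have /nbhs_ballP[r /= r0 rU] : nbhs a U by exact: open_nbhs_nbhs.
have r20 : 0 < r / 2 by rewrite divr_gt0.
have [b [sb ba bs]] := bump_ball a r20.
exists b, [set x | `|x - a| <= r / 2]; split => //.
- apply: bounded_closed_compact.
    exists (`|a| + r / 2); split; first exact: num_real.
    move=> M hM x /= hx; apply: le_trans (ltW hM).
    by rewrite -{1}(subrK a x) addrC (le_trans (ler_normD _ _))// lerD2l.
  have := @closed_closed_ball_ R 'rV[R]_n a (r / 2).
  by congr closed; apply/seteqP; split => x; rewrite /closed_ball_ /= distrC.
- move=> x /= hx; apply: rU; rewrite -ball_normE /= distrC.
  by apply: le_lt_trans hx _; rewrite ltr_pdivrMr// ltr_pMr// ltr1n.
- move=> x nK; apply/eqP; apply/negPn/negP => /bs H; exact: nK.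
Qed.

End Bump.

(** * Bivectors and symmetric bilinear forms *)

Section Bivectors.
Variable R : realType.
Implicit Types (v w x y : 'rV[R]_4) (xi eta : bivector R).

Lemma bivP xi eta : (forall i j, bivector_val xi i j = bivector_val eta i j) -> xi = eta.
Proof. by move=> H; apply: val_inj; apply/matrixP. Qed.

Lemma bivD xi eta i j : bivector_val (xi + eta) i j = bivector_val xi i j + bivector_val eta i j.
Proof. by rewrite -[bivector_val (xi + eta)]/(val (xi + eta)) raddfD mxE. Qed.

Lemma bivZ a xi i j : bivector_val (a *: xi) i j = a * bivector_val xi i j.
Proof. by rewrite -[bivector_val (a *: xi)]/(val (a *: xi)) linearZ mxE. Qed.

Lemma bivN xi i j : bivector_val (- xi) i j = - bivector_val xi i j.
Proof. by rewrite -[bivector_val (- xi)]/(val (- xi)) raddfN mxE. Qed.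

Lemma biv0 i j : bivector_val (0 : bivector R) i j = 0.
Proof. by rewrite -[bivector_val 0]/(val (0 : bivector R)) raddf0 mxE. Qed.

Lemma wedgeE v w i j : bivector_val (wedge v w) i j = v 0 i * w 0 j - w 0 i * v 0 j.
Proof. by rewrite /= !mxE !big_ord1 !mxE. Qed.

Definition bivE := (bivD, bivZ, bivN, biv0, wedgeE).

Lemma wedgeC v w : wedge v w = - wedge w v.
Proof. by apply: bivP => i j; rewrite !bivE opprB. Qed.

Lemma wedge_linl a v v' w : wedge (a *: v + v') w = a *: wedge v w + wedge v' w.
Proof. apply: bivP => i j; rewrite !bivE !mxE; ring. Qed.

Lemma wedge_linr a v v' w : wedge w (a *: v + v') = a *: wedge w v + wedge w v'.
Proof. apply: bivP => i j; rewrite !bivE !mxE; ring. Qed.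

Lemma wedge0l w : wedge 0 w = 0.
Proof. by apply: bivP => i j; rewrite !bivE !mxE !(mul0r, mulr0) subrr. Qed.

Lemma wedge0r w : wedge w 0 = 0.
Proof. by rewrite wedgeC wedge0l oppr0. Qed.

Lemma ord4_ind (P : 'I_4 -> Prop) : P 0 -> P 1 -> P 2 -> P 3 -> forall i, P i.
Proof.
move=> P0 P1 P2 P3 [[|[|[|[|//]]]] hi].
- by have -> : Ordinal hi = 0 by apply: val_inj.
- by have -> : Ordinal hi = 1 by apply: val_inj.
- by have -> : Ordinal hi = 2 by apply: val_inj.
- by have -> : Ordinal hi = 3 by apply: val_inj.
Qed.

Lemma sum4 (V : zmodType) (F : 'I_4 -> V) : \sum_i F i = F 0 + F 1 + F 2 + F 3.
Proof.
rewrite !big_ord_recl big_ord0 addr0 !addrA.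
by congr (F _ + F _ + F _ + F _); apply: val_inj.
Qed.

Lemma det3 (A : 'M[R]_3) : \det A =
  A 0 0 * (A 1 1 * A 2 2 - A 1 2 * A 2 1)
  - A 0 1 * (A 1 0 * A 2 2 - A 1 2 * A 2 0)
  + A 0 2 * (A 1 0 * A 2 1 - A 1 1 * A 2 0).
Proof.
pose a (i j : nat) : R := A (inord i) (inord j).
have aE (i j : 'I_3) : A i j = a i j by rewrite /a !inord_val.
rewrite (expand_det_row _ 0) !big_ord_recl big_ord0 /cofactor.
rewrite !(expand_det_row _ 0) !big_ord_recl !big_ord0 /cofactor !det_mx11 !mxE.
rewrite !aE /= /bump /= ?expr0 ?expr1 ?exprS.
ring.
Qed.

Lemma det4 (A : 'M[R]_4) : \det A =
    A 0 0 * (A 1 1 * (A 2 2 * A 3 3 - A 2 3 * A 3 2) - A 1 2 * (A 2 1 * A 3 3 - A 2 3 * A 3 1)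
             + A 1 3 * (A 2 1 * A 3 2 - A 2 2 * A 3 1))
  - A 0 1 * (A 1 0 * (A 2 2 * A 3 3 - A 2 3 * A 3 2) - A 1 2 * (A 2 0 * A 3 3 - A 2 3 * A 3 0)
             + A 1 3 * (A 2 0 * A 3 2 - A 2 2 * A 3 0))
  + A 0 2 * (A 1 0 * (A 2 1 * A 3 3 - A 2 3 * A 3 1) - A 1 1 * (A 2 0 * A 3 3 - A 2 3 * A 3 0)
             + A 1 3 * (A 2 0 * A 3 1 - A 2 1 * A 3 0))
  - A 0 3 * (A 1 0 * (A 2 1 * A 3 2 - A 2 2 * A 3 1) - A 1 1 * (A 2 0 * A 3 2 - A 2 2 * A 3 0)
             + A 1 2 * (A 2 0 * A 3 1 - A 2 1 * A 3 0)).
Proof.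
pose a (i j : nat) : R := A (inord i) (inord j).
have aE (i j : 'I_4) : A i j = a i j by rewrite /a !inord_val.
rewrite (expand_det_row _ 0) sum4 /cofactor !det3 !mxE.
rewrite !aE /= /bump /= ?expr0 ?expr1 ?expr2 ?exprS.
ring.
Qed.

Lemma wedge22D xi eta zeta : wedge22 xi (eta + zeta) = wedge22 xi eta + wedge22 xi zeta.
Proof.
rewrite /wedge22 -mulrDr -big_split; congr (_ * _); apply: eq_bigr => s _ /=.
by rewrite bivD !mulrDr.
Qed.

Lemma wedge22Z a xi eta : wedge22 xi (a *: eta) = a * wedge22 xi eta.
Proof.
rewrite /wedge22 [RHS]mulrCA; congr (_ * _); rewrite mulr_sumr; apply: eq_bigr => s _ /=.
by rewrite bivZ (mulrCA (bivector_val xi _ _) a) (mulrCA _ a).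
Qed.

(** The factor one half: each pair of indices occurs twice. *)
Lemma wedge_sum_delta xi :
  xi = \sum_i \sum_j (2^-1 * bivector_val xi i j) *: wedge (delta_mx 0 i) (delta_mx 0 j).
Proof.
have bsum (I : finType) (F : I -> bivector R) k l :
    bivector_val (\sum_i F i) k l = \sum_i bivector_val (F i) k l.
  by elim/big_rec2: _ => [|i y1 y2 _ <-]; rewrite ?biv0// bivD.
apply: bivP => k l; rewrite bsum.
have sk : bivector_val xi l k = - bivector_val xi k l.
  case: xi => X /= hX; move: (hX); rewrite unfold_in /Defs.skew => /eqP /matrixP /(_ k l).
  by rewrite !mxE.
have pick1 (F : 'I_4 -> R) m : \sum_i F i * (i == m)%:R = F m.
  by rewrite (bigD1 m)//= eqxx mulr1 big1 ?addr0// => i /negbTE ->; rewrite mulr0.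
transitivity (\sum_i ((\sum_j 2^-1 * bivector_val xi i j * (j == l)%:R) * (i == k)%:R
   - (\sum_j 2^-1 * bivector_val xi i j * (j == k)%:R) * (i == l)%:R)).
  by rewrite sumrB !pick1 sk; field.
apply: eq_bigr => i _; rewrite bsum !mulr_suml -sumrB; apply: eq_bigr => j _.
rewrite bivZ wedgeE !mxE !eqxx /= [i == k]eq_sym [i == l]eq_sym [j == k]eq_sym [j == l]eq_sym.
ring.
Qed.

End Bivectors.

Definition bilinear_form (R : realType) (B : 'rV[R]_4 -> 'rV[R]_4 -> R) :=
  (forall a v v' w, B (a *: v + v') w = a * B v w + B v' w) /\
  (forall a v v' w, B w (a *: v + v') = a * B w v + B w v').

Section Form.
Variables (R : realType) (b : 'rV[R]_4 -> 'rV[R]_4 -> R).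
Hypothesis bsym : forall u v, b u v = b v u.
Hypothesis blin : forall u (a : R) v w, b u (a *: v + w) = a * b u v + b u w.
Implicit Types (u v w x y : 'rV[R]_4) (xi eta : bivector R).

Lemma form0r u : b u 0 = 0.
Proof. by have := blin u (-1) 0 0; rewrite scaleN1r oppr0 addr0 mulN1r addNr. Qed.
Lemma formDr u v w : b u (v + w) = b u v + b u w.
Proof. by have := blin u 1 v w; rewrite scale1r mul1r. Qed.
Lemma formZr u a v : b u (a *: v) = a * b u v.
Proof. by rewrite -[a *: v]addr0 blin form0r addr0. Qed.
Lemma formNr u v : b u (- v) = - b u v.
Proof. by rewrite -scaleN1r formZr mulN1r. Qed.
Lemma formDl u v w : b (v + w) u = b v u + b w u.
Proof. by rewrite !(bsym _ u) formDr. Qed.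
Lemma formZl u a v : b (a *: v) u = a * b v u.
Proof. by rewrite !(bsym _ u) formZr. Qed.
Lemma formNl u v : b (- v) u = - b v u.
Proof. by rewrite !(bsym _ u) formNr. Qed.

Lemma ip2_sym xi eta : ip2 b xi eta = ip2 b eta xi.
Proof.
rewrite /ip2; congr (_ * _).
under eq_bigr => i _ do rewrite exchange_big /=.
rewrite exchange_big /=; apply: eq_bigr => k _.
under eq_bigr => i _ do rewrite exchange_big /=.
rewrite exchange_big /=; apply: eq_bigr => l _.
apply: eq_bigr => i _; apply: eq_bigr => j _.
by rewrite (bsym (delta_mx 0 i)) (bsym (delta_mx 0 j)); ring.
Qed.

Lemma ip2Dl xi eta zeta : ip2 b (xi + eta) zeta = ip2 b xi zeta + ip2 b eta zeta.
Proof.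
rewrite /ip2 -mulrDr; congr (_ * _).
do 4 (rewrite -big_split; apply: eq_bigr => ? _ /=).
rewrite bivD; ring.
Qed.
Lemma ip2Zl a xi zeta : ip2 b (a *: xi) zeta = a * ip2 b xi zeta.
Proof.
rewrite /ip2 [RHS]mulrCA; congr (_ * _).
do 4 (rewrite mulr_sumr; apply: eq_bigr => ? _ /=).
rewrite bivZ; ring.
Qed.
Lemma ip2Dr xi eta zeta : ip2 b zeta (xi + eta) = ip2 b zeta xi + ip2 b zeta eta.
Proof. by rewrite ip2_sym ip2Dl !(ip2_sym zeta). Qed.
Lemma ip2Zr a xi zeta : ip2 b zeta (a *: xi) = a * ip2 b zeta xi.
Proof. by rewrite ip2_sym ip2Zl (ip2_sym zeta). Qed.
Lemma ip2Nl xi zeta : ip2 b (- xi) zeta = - ip2 b xi zeta.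
Proof. by rewrite -scaleN1r ip2Zl mulN1r. Qed.
Lemma ip2Nr xi zeta : ip2 b zeta (- xi) = - ip2 b zeta xi.
Proof. by rewrite -scaleN1r ip2Zr mulN1r. Qed.
Lemma ip20l zeta : ip2 b 0 zeta = 0.
Proof. by rewrite -(scale0r 0) ip2Zl mul0r. Qed.
Lemma ip20r zeta : ip2 b zeta 0 = 0.
Proof. by rewrite ip2_sym ip20l. Qed.

Definition ip2E := (ip2Dl, ip2Dr, ip2Zl, ip2Zr, ip2Nl, ip2Nr, ip20l, ip20r).

Lemma form_matrix u v : b u v = (u *m (\matrix_(i, j) b (delta_mx 0 i) (delta_mx 0 j)) *m v^T) 0 0.
Proof.
have suml (s : seq 'I_4) (c : 'I_4 -> R) (w : 'I_4 -> 'rV[R]_4) z :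
    b z (\sum_(i <- s) c i *: w i) = \sum_(i <- s) c i * b z (w i).
  by elim: s => [|i s IH]; rewrite ?big_nil ?form0r// !big_cons blin IH.
rewrite mxE {1}(row_sum_delta v) suml; apply: eq_bigr => j _.
rewrite !mxE mulrC; congr (_ * _).
rewrite bsym {1}(row_sum_delta u) suml; apply: eq_bigr => i _.
by rewrite mxE bsym.
Qed.

Lemma gram_matrix (f : 'I_4 -> 'rV[R]_4) :
  (\matrix_i f i) *m ((\matrix_(i, j) b (delta_mx 0 i) (delta_mx 0 j)) *m (\matrix_i f i)^T)
    = \matrix_(i, j) b (f i) (f j).
Proof.
apply/matrixP => i j; rewrite mxE [RHS]mxE form_matrix.
rewrite -mulmxA mxE; apply: eq_bigr => k _; rewrite mxE; congr (_ * _).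
by rewrite !mxE; apply: eq_bigr => l _; rewrite !mxE.
Qed.

Lemma form_bilinear : bilinear_form b.
Proof. by split=> a v v' w; rewrite ?formDl ?formZl// blin. Qed.

Variable e : 'I_4 -> 'rV[R]_4.
Hypothesis fe : orthonormal_frame b e.

Lemma frame_expand v : v = \sum_k b v (e k) *: e k.
Proof.
pose B : 'M[R]_4 := \matrix_(i, j) b (delta_mx 0 i) (delta_mx 0 j).
pose E : 'M[R]_4 := \matrix_i e i.
have H : E *m (B *m E^T) = 1%:M.
  by rewrite gram_matrix; apply/matrixP => i j; rewrite !mxE fe.
have {}H := mulmx1C H.
rewrite -[LHS]mulmx1 -H !mulmxA.
apply/rowP => j; rewrite mxE summxE; apply: eq_bigr => k _.
rewrite !mxE; congr (_ * _); rewrite form_matrix -/B mxE; apply: eq_bigr => l _.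
by rewrite !mxE.
Qed.

(** Linear statements about bivectors need only be checked on the wedges of two
    vectors of an orthonormal frame. *)
Lemma biv_ind (P : bivector R -> Prop) :
  (forall a xi eta, P xi -> P eta -> P (a *: xi + eta)) ->
  (forall i j, P (wedge (e i) (e j))) -> forall xi, P xi.
Proof.
move=> Plin Pe.
have P0 : P 0 by have := Plin (-1) _ _ (Pe 0 0) (Pe 0 0); rewrite scaleN1r addNr.
have Pw v w : P (wedge v w).
  have H1 i : P (wedge (e i) w).
    rewrite (frame_expand w); elim: (index_enum _) => [|k s IH].
      by rewrite big_nil wedge0r.
    by rewrite big_cons wedge_linr; apply: Plin.
  rewrite (frame_expand v); elim: (index_enum _) => [|k s IH].
    by rewrite big_nil wedge0l.
  by rewrite big_cons wedge_linl; apply: Plin.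
have PZ a xi : P xi -> P (a *: xi) by move=> Px; rewrite -[a *: xi]addr0; exact: Plin.
have PD xi eta : P xi -> P eta -> P (xi + eta).
  by move=> Px Py; rewrite -[xi]scale1r; exact: Plin.
have Ps (F : 'I_4 -> bivector R) : (forall i, P (F i)) -> P (\sum_i F i).
  by move=> PF; elim/big_ind: _ => // x y; exact: PD.
by move=> xi; rewrite (wedge_sum_delta xi); apply: (Ps) => i; apply: (Ps) => j; apply: PZ; exact: Pw.
Qed.
End Form.

(** * The Hodge star in an orthonormal frame *)

Lemma wedge22_explicit (R : realType) (v w x y : 'rV[R]_4) :
  wedge22 (wedge v w) (wedge x y) =
    v 0 0 * (w 0 1 * (x 0 2 * y 0 3 - x 0 3 * y 0 2) - w 0 2 * (x 0 1 * y 0 3 - x 0 3 * y 0 1)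
             + w 0 3 * (x 0 1 * y 0 2 - x 0 2 * y 0 1))
  - v 0 1 * (w 0 0 * (x 0 2 * y 0 3 - x 0 3 * y 0 2) - w 0 2 * (x 0 0 * y 0 3 - x 0 3 * y 0 0)
             + w 0 3 * (x 0 0 * y 0 2 - x 0 2 * y 0 0))
  + v 0 2 * (w 0 0 * (x 0 1 * y 0 3 - x 0 3 * y 0 1) - w 0 1 * (x 0 0 * y 0 3 - x 0 3 * y 0 0)
             + w 0 3 * (x 0 0 * y 0 1 - x 0 1 * y 0 0))
  - v 0 3 * (w 0 0 * (x 0 1 * y 0 2 - x 0 2 * y 0 1) - w 0 1 * (x 0 0 * y 0 2 - x 0 2 * y 0 0)
             + w 0 2 * (x 0 0 * y 0 1 - x 0 1 * y 0 0)).
Proof. by rewrite wedge22_wedge det4 !mxE. Qed.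

Lemma wedge22C (R : realType) (v w x y : 'rV[R]_4) :
  wedge22 (wedge v w) (wedge x y) = wedge22 (wedge x y) (wedge v w).
Proof. by rewrite !wedge22_explicit; ring. Qed.

Lemma wedge22_shared (R : realType) (v w x : 'rV[R]_4) :
  (wedge22 (wedge v w) (wedge v x) = 0) * (wedge22 (wedge v w) (wedge x v) = 0)
  * (wedge22 (wedge w v) (wedge v x) = 0) * (wedge22 (wedge w v) (wedge x v) = 0).
Proof.
by split; [split; [split|]|]; rewrite wedge22_explicit; ring.
Qed.

Section Frame.
Variables (R : realType) (b : 'rV[R]_4 -> 'rV[R]_4 -> R).
Hypothesis bsym : forall u v, b u v = b v u.
Hypothesis blin : forall u (a : R) v w, b u (a *: v + w) = a * b u v + b u w.
Implicit Types (u v w x y : 'rV[R]_4) (xi eta : bivector R).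
Implicit Types e : 'I_4 -> 'rV[R]_4.

Lemma ip2_frame e i j k l : orthonormal_frame b e ->
  ip2 b (wedge (e i) (e j)) (wedge (e k) (e l))
    = (i == k)%:R * (j == l)%:R - (i == l)%:R * (j == k)%:R.
Proof. by move=> fe; rewrite ip2_wedge// !fe. Qed.

Local Notation W e i j := (wedge (e i) (e j)).

(** The six coordinate planes of an orthonormal frame are an orthonormal basis of
    the bivectors. They are listed so that each of the last three is dual to the
    corresponding one of the first three. *)
Lemma biv_expand e xi : orthonormal_frame b e -> xi =
  ip2 b xi (W e 0 1) *: W e 0 1 + ip2 b xi (W e 0 2) *: W e 0 2 + ip2 b xi (W e 0 3) *: W e 0 3
  + ip2 b xi (W e 2 3) *: W e 2 3 + ip2 b xi (W e 3 1) *: W e 3 1 + ip2 b xi (W e 1 2) *: W e 1 2.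
Proof.
move=> fe.
pose ws := [:: W e 0 1; W e 0 2; W e 0 3; W e 2 3; W e 3 1; W e 1 2].
suff E : xi = \sum_(w <- ws) ip2 b xi w *: w.
  by rewrite [LHS]E !big_cons big_nil addr0 !addrA.
apply: (biv_ind bsym blin fe (P := fun xi => xi = \sum_(w <- ws) ip2 b xi w *: w)) xi.
  move=> a xi eta Hx He; rewrite {1}Hx {1}He scaler_sumr -big_split /=.
  by apply: eq_bigr => w _; rewrite ip2Dl ip2Zl scalerDl scalerA.
move=> i j; rewrite !big_cons big_nil !ip2_frame//; apply: bivP => k l; rewrite !bivE.
move: i j; do 2 (apply: ord4_ind); rewrite /= ?eqxx /=; ring.
Qed.

Lemma frame_gram_det e : orthonormal_frame b e ->
  \det (\matrix_i e i) * (\det (\matrix_(i, j) b (delta_mx 0 i) (delta_mx 0 j))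
    * \det (\matrix_i e i)) = 1.
Proof.
move=> fe.
have H := gram_matrix bsym blin e.
rewrite (_ : \matrix_(i, j) b (e i) (e j) = 1%:M) in H; last first.
  by apply/matrixP => i j; rewrite !mxE fe.
by have := congr1 determinant H; rewrite !det_mulmx det_tr det1.
Qed.

Lemma det_frame_neq0 e : orthonormal_frame b e -> \det (\matrix_i e i) != 0.
Proof.
move=> /frame_gram_det H; apply/eqP => D0; move/eqP: H.
by rewrite D0 mul0r eq_sym oner_eq0.
Qed.

Lemma gram_det_neq0 e : orthonormal_frame b e ->
  \det (\matrix_(i, j) b (delta_mx 0 i) (delta_mx 0 j)) != 0.
Proof.
move=> /frame_gram_det H; apply/eqP => D0; move/eqP: H.
by rewrite D0 mul0r mulr0 eq_sym oner_eq0.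
Qed.

(** Wedging with a coordinate plane reads off the coordinate along the dual
    plane, since all the other coordinate planes share a vector with it. *)
Lemma wedge22_frame e zeta : orthonormal_frame b e ->
  [/\ wedge22 (W e 2 3) zeta = ip2 b zeta (W e 0 1) * \det (\matrix_i e i),
      wedge22 (W e 3 1) zeta = ip2 b zeta (W e 0 2) * \det (\matrix_i e i) &
      wedge22 (W e 1 2) zeta = ip2 b zeta (W e 0 3) * \det (\matrix_i e i)] /\
  [/\ wedge22 (W e 0 1) zeta = ip2 b zeta (W e 2 3) * \det (\matrix_i e i),
      wedge22 (W e 0 2) zeta = ip2 b zeta (W e 3 1) * \det (\matrix_i e i) &
      wedge22 (W e 0 3) zeta = ip2 b zeta (W e 1 2) * \det (\matrix_i e i)].
Proof.
move=> fe; have Z := biv_expand zeta fe.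
have dE : wedge22 (W e 0 1) (W e 2 3) = \det (\matrix_i e i)
    /\ wedge22 (W e 0 2) (W e 3 1) = \det (\matrix_i e i)
    /\ wedge22 (W e 0 3) (W e 1 2) = \det (\matrix_i e i).
  by split; [|split]; rewrite wedge22_explicit det4 !mxE; ring.
have [d1 [d2 d3]] := dE.
have d := (d1, d2, d3).
have d' : (wedge22 (W e 2 3) (W e 0 1) = \det (\matrix_i e i))
    * (wedge22 (W e 3 1) (W e 0 2) = \det (\matrix_i e i))
    * (wedge22 (W e 1 2) (W e 0 3) = \det (\matrix_i e i)).
  by rewrite (wedge22C (e 2)) (wedge22C (e 3)) (wedge22C (e 1)) d1 d2 d3.
by split; split; rewrite {1}Z !(wedge22D, wedge22Z) !(d, d') !wedge22_shared
  !mulr0 !(addr0, add0r).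
Qed.

(** The Hodge star in a frame of either orientation, [s] being the sign of the
    orientation. *)
Definition star_table (star : bivector R -> bivector R) e (s : R) :=
  [/\ star (W e 0 1) = s *: W e 2 3, star (W e 0 2) = s *: W e 3 1 &
      star (W e 0 3) = s *: W e 1 2] /\
  [/\ star (W e 2 3) = s *: W e 0 1, star (W e 3 1) = s *: W e 0 2 &
      star (W e 1 2) = s *: W e 0 3].

(** By [wedge22_frame] the equations defining [star eta] are its coordinates. *)
Lemma star_positive_frame (star : bivector R -> bivector R) e :
  is_hodge_star b star -> orthonormal_frame b e -> 0 < \det (\matrix_i e i) ->
  star_table star e 1.
Proof.
move=> hs fe D0; have D1 := lt0r_neq0 D0.
have L eta : star eta = ip2 b eta (W e 2 3) *: W e 0 1 + ip2 b eta (W e 3 1) *: W e 0 2 +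
    ip2 b eta (W e 1 2) *: W e 0 3 + ip2 b eta (W e 0 1) *: W e 2 3 +
    ip2 b eta (W e 0 2) *: W e 3 1 + ip2 b eta (W e 0 3) *: W e 1 2.
  have [[E1 E2 E3] [E4 E5 E6]] := wedge22_frame (star eta) fe.
  rewrite {1}(biv_expand (star eta) fe).
  rewrite !(hs e fe D0) !(ip2_sym bsym _ eta) in E1 E2 E3 E4 E5 E6.
  by rewrite -(mulIf D1 E1) -(mulIf D1 E2) -(mulIf D1 E3) -(mulIf D1 E4) -(mulIf D1 E5) -(mulIf D1 E6).
by split; split; rewrite L !ip2_frame//= ?eqxx /=; apply: bivP => i j; rewrite !bivE; ring.
Qed.

Definition flip_frame e (i : 'I_4) : 'rV[R]_4 := if i == 0 then - e 0 else e i.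

Lemma flip_frame_orthonormal e : orthonormal_frame b e -> orthonormal_frame b (flip_frame e).
Proof.
move=> fe i j; rewrite /flip_frame; have := fe i j.
case: (eqVneq i 0) => [->|i0]; case: (eqVneq j 0) => [->|j0];
  rewrite ?(formNl bsym blin) ?(formNr blin) ?fe ?opprK ?eqxx//.
- by rewrite eq_sym (negbTE j0) oppr0.
- by rewrite (negbTE i0) oppr0.
Qed.

Lemma det_flip_frame e : \det (\matrix_i flip_frame e i) = - \det (\matrix_i e i).
Proof. by rewrite !det4 !mxE /flip_frame /= ?mxE; ring. Qed.

Lemma positive_frame e : orthonormal_frame b e ->
  exists2 f, orthonormal_frame b f & 0 < \det (\matrix_i f i).
Proof.
move=> fe; have [D0|] := ltP 0 (\det (\matrix_i e i)); first by exists e.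
rewrite le_eqVlt (negbTE (det_frame_neq0 fe)) /= => D0.
by exists (flip_frame e); [exact: flip_frame_orthonormal|rewrite det_flip_frame oppr_gt0].
Qed.

(** Reversing one vector of a negative frame makes it positive and changes the
    sign of exactly one plane in each dual pair. *)
Lemma star_frame (star : {linear bivector R -> bivector R}) e :
  is_hodge_star b star -> orthonormal_frame b e ->
  exists2 s : R, s * s = 1 & star_table star e s.
Proof.
move=> hs fe; have [D0|] := ltP 0 (\det (\matrix_i e i)).
  by exists 1; [rewrite mulr1|exact: star_positive_frame].
rewrite le_eqVlt (negbTE (det_frame_neq0 fe)) /= => D0.
have fD : 0 < \det (\matrix_i flip_frame e i) by rewrite det_flip_frame oppr_gt0.
have [[S1 S2 S3] [S4 S5 S6]] := star_positive_frame hs (flip_frame_orthonormal fe) fD.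
have fW j : wedge (- e 0) (e j) = - wedge (e 0) (e j).
  by apply: bivP => k l; rewrite !bivE !mxE; ring.
rewrite /flip_frame /= !fW ?linearN /= !scale1r in S1 S2 S3 S4 S5 S6.
exists (-1); first by rewrite mulN1r opprK.
split; first by split; rewrite scaleN1r -?S1 -?S2 -?S3 opprK.
by split; rewrite scaleN1r ?S4 ?S5 ?S6.
Qed.

End Frame.

(** * Algebraic curvature tensors *)

Section CurvatureArray.
Variables (R : realType) (T : Type) (q : T -> T -> T -> T -> R).
Hypothesis anti1 : forall v w x y, q v w x y = - q w v x y.
Hypothesis anti2 : forall v w x y, q v w x y = - q v w y x.
Hypothesis bianchi : forall v w x y, q v w x y + q w x v y + q x v w y = 0.

(** The classical argument: the four Bianchi identities of the faces of a
    tetrahedron with vertices [v], [w], [x], [y], combined with signs. *)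
Lemma pair_symmetry v w x y : q v w x y = q x y v w.
Proof.
have := bianchi v w x y; have := bianchi w x y v.
have := bianchi x y v w; have := bianchi y v w x.
rewrite (anti2 w x y v) (anti2 x y w v) (anti1 y w x v) (anti1 y v x w) (anti2 v y x w).
rewrite (anti1 v x y w) (anti2 x v y w) (anti1 y v w x) (anti2 v w y x) (anti2 w y v x).
lra.
Qed.

Lemma array_alt v x y : q v v x y = 0.
Proof. by have := anti1 v v x y; lra. Qed.

End CurvatureArray.

Section RicciArray.
Variables (R : realType) (r : 'I_4 -> 'I_4 -> 'I_4 -> 'I_4 -> R).
Hypothesis anti1 : forall v w x y, r v w x y = - r w v x y.
Hypothesis anti2 : forall v w x y, r v w x y = - r v w y x.
Hypothesis bianchi : forall v w x y, r v w x y + r w x v y + r x v w y = 0.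

Let alt1 := array_alt anti1.
Lemma array_alt2 v x y : r x y v v = 0.
Proof. by have := anti2 x y v v; lra. Qed.

Let rsym := pair_symmetry anti1 anti2 bianchi.
(* Rewriting rules that bring every component to one of the 21 components in
   which both pairs belong to 01, 02, 03, 23, 31, 12, in this order. *)
Let first := (anti1 1 0, anti1 2 0, anti1 3 0, anti1 3 2, anti1 1 3, anti1 2 1).
Let second := (fun i j => anti2 i j 1 0, fun i j => anti2 i j 2 0, fun i j => anti2 i j 3 0,
  fun i j => anti2 i j 3 2, fun i j => anti2 i j 1 3, fun i j => anti2 i j 2 1).
Let flip := (rsym 0 2 0 1, rsym 0 3 0 1, rsym 0 3 0 2,
  rsym 2 3 0 1, rsym 2 3 0 2, rsym 2 3 0 3, rsym 3 1 0 1, rsym 3 1 0 2, rsym 3 1 0 3,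
  rsym 1 2 0 1, rsym 1 2 0 2, rsym 1 2 0 3, rsym 3 1 2 3, rsym 1 2 2 3, rsym 1 2 3 1).

(** Invariance under the exchange of each of the planes 01, 02, 03 with its dual
    23, 31, 12, restricted to the equations which do not follow from the symmetry
    of the array. *)
Definition dual_invariant :=
  [/\ r 2 3 2 3 = r 0 1 0 1, r 3 1 3 1 = r 0 2 0 2 & r 1 2 1 2 = r 0 3 0 3] /\
  [/\ r 2 3 3 1 = r 0 1 0 2, r 2 3 1 2 = r 0 1 0 3 & r 3 1 1 2 = r 0 2 0 3] /\
  [/\ r 2 3 0 2 = r 0 1 3 1, r 2 3 0 3 = r 0 1 1 2 & r 3 1 0 3 = r 0 2 1 2].

(** A diagonal entry of the contraction is the sum of the three sectional
    curvatures of the planes through one vector, and duality turns these into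
    the planes through any other vector. An off-diagonal entry has two terms,
    which duality makes opposite. *)
Lemma ricci_of_dual : dual_invariant -> forall j k,
  \sum_i r i j i k = (r 0 1 0 1 + r 0 2 0 2 + r 0 3 0 3) * (j == k)%:R.
Proof.
move=> [[h1 h2 h3] [[h4 h5 h6] [h7 h8 h9]]]; do 2 (apply: ord4_ind); rewrite sum4 /= ?eqxx /=.
all: rewrite ?alt1 ?array_alt2 ?first ?second ?flip.
all: rewrite ?flip in h1 h2 h3 h4 h5 h6 h7 h8 h9; lra.
Qed.

(** The differences of the diagonal equations equate dual diagonal components;
    the off-diagonal equations give the rest. Both steps are linear algebra. *)
Lemma dual_of_ricci f : (forall j k, \sum_i r i j i k = f * (j == k)%:R) -> dual_invariant.
Proof.
move=> H.
have := (H 0 0, H 1 1, H 2 2, H 3 3, (H 0 1, H 0 2, H 0 3, H 1 2, H 1 3, H 2 3)).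
rewrite !sum4 /= ?eqxx /= ?alt1 ?array_alt2 ?first ?second ?flip => -[[[[]]]] + + + + [[[[[]]]]].
move=> h1 h2 h3 h4 h5 h6 h7 h8 h9 h10.
by split; [|split]; split; rewrite ?first ?second ?flip; lra.
Qed.
End RicciArray.

Section Planes.
Variables (R : realType) (b : 'rV[R]_4 -> 'rV[R]_4 -> R).
Hypothesis bsym : forall u v, b u v = b v u.
Hypothesis blin : forall u (a : R) v w, b u (a *: v + w) = a * b u v + b u w.
Implicit Types (u v w x y : 'rV[R]_4) (xi eta : bivector R).
Let ipE := ip2E bsym.

(** The coordinate planes as two dual triples: [d] tells whether the plane misses
    [e 0], and [plane e true k] is the dual of [plane e false k]. *)
Definition plane (e : 'I_4 -> 'rV[R]_4) (d : bool) (k : 'I_3) : bivector R :=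
  if d then
    if k == 0 then wedge (e 2) (e 3) else if k == 1 then wedge (e 3) (e 1) else wedge (e 1) (e 2)
  else wedge (e 0) (e (lift ord0 k)).

Arguments plane : simpl never.

Lemma ord3_ind (P : 'I_3 -> Prop) : P 0 -> P 1 -> P 2 -> forall i, P i.
Proof.
move=> P0 P1 P2 [[|[|[|//]]] hi].
- by have -> : Ordinal hi = 0 by apply: val_inj.
- by have -> : Ordinal hi = 1 by apply: val_inj.
- by have -> : Ordinal hi = 2 by apply: val_inj.
Qed.

Lemma lift_ord3 : (lift ord0 (0 : 'I_3) = 1 :> 'I_4) * (lift ord0 (1 : 'I_3) = 2 :> 'I_4)
  * (lift ord0 (2 : 'I_3) = 3 :> 'I_4).
Proof. by split; [split|]; apply: val_inj. Qed.

Lemma planeE e : (plane e false 0 = wedge (e 0) (e 1)) * (plane e false 1 = wedge (e 0) (e 2))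
  * (plane e false 2 = wedge (e 0) (e 3)) * (plane e true 0 = wedge (e 2) (e 3))
  * (plane e true 1 = wedge (e 3) (e 1)) * (plane e true 2 = wedge (e 1) (e 2)).
Proof. by rewrite /plane /= !lift_ord3. Qed.

Lemma sum3 (V : zmodType) (G : 'I_3 -> V) : \sum_i G i = G 0 + G 1 + G 2.
Proof.
rewrite !big_ord_recl big_ord0 addr0 !addrA.
by congr (G _ + G _ + G _); apply: val_inj.
Qed.

Variable e : 'I_4 -> 'rV[R]_4.
Hypothesis fe : orthonormal_frame b e.
Local Notation P := (plane e).

Lemma ip2_plane d k d' k' : ip2 b (P d k) (P d' k') = ((d == d') && (k == k'))%:R.
Proof.
move: k k'; case: d; case: d'; do 2 (apply: ord3_ind);
  rewrite !planeE ip2_frame//= ?eqxx /=; ring.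
Qed.

Lemma plane_expand xi : xi = \sum_k (ip2 b xi (P false k) *: P false k + ip2 b xi (P true k) *: P true k).
Proof.
rewrite sum3 !planeE {1}(biv_expand bsym blin xi fe).
by rewrite [LHS](ACl ((1*4)*(2*5)*(3*6))%AC).
Qed.

Lemma plane_eq xi eta : (forall d k, ip2 b xi (P d k) = ip2 b eta (P d k)) -> xi = eta.
Proof. by move=> H; rewrite (plane_expand xi) (plane_expand eta); apply: eq_bigr => k _; rewrite !H. Qed.

Variables (star : {linear bivector R -> bivector R}) (s : R).
Hypotheses (s1 : s * s = 1) (star_e : star_table star e s).

Lemma sign_neq0 : s != 0.
Proof. by apply/eqP => s0; move: s1; rewrite s0 mul0r => /esym/eqP; rewrite oner_eq0. Qed.

Lemma star_plane d k : star (P d k) = s *: P (~~ d) k.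
Proof.
have [[S1 S2 S3] [S4 S5 S6]] := star_e.
by move: k; case: d; apply: ord3_ind; rewrite /= !planeE.
Qed.

Lemma star_coef xi d k : ip2 b (star xi) (P d k) = s * ip2 b xi (P (~~ d) k).
Proof.
rewrite {1}(plane_expand xi) !sum3 !linearD !linearZ /= !star_plane /= !ipE !ip2_plane.
by move: k; case: d; apply: ord3_ind; rewrite /=; ring.
Qed.

Lemma star_sym xi eta : ip2 b (star xi) eta = ip2 b xi (star eta).
Proof.
rewrite [in LHS](plane_expand eta) [in RHS](plane_expand eta) !sum3 !linearD !linearZ /=.
by rewrite !star_plane !ipE !star_coef /=; ring.
Qed.

Lemma star_star xi : star (star xi) = xi.
Proof. by apply: plane_eq => d k; rewrite !star_coef negbK mulrA s1 mul1r. Qed.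

(** The star permutes the coordinate planes up to one common sign, which occurs
    twice in each matrix entry and cancels. *)
Lemma commute_array (F : {linear bivector R -> bivector R}) :
  (forall xi, F (star xi) = star (F xi)) <->
  (forall d k d' k', ip2 b (F (P (~~ d) k)) (P (~~ d') k') = ip2 b (F (P d k)) (P d' k')).
Proof.
split=> [H d k d' k'|H xi].
  have := congr1 (fun z => ip2 b z (P (~~ d') k')) (H (P d k)).
  rewrite /= star_coef star_plane linearZ /= !ipE negbK.
  exact: (mulfI sign_neq0).
rewrite (plane_expand xi) !linear_sum; apply: eq_bigr => k _.
rewrite !linearD !linearZ /=.
have K d : F (star (P d k)) = star (F (P d k)).
  apply: plane_eq => d' k'; rewrite star_coef star_plane linearZ /= !ipE.
  by rewrite -H !negbK.
by rewrite !K.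
Qed.

End Planes.
Arguments plane {R} e d k : simpl never.

(** * Curvature operators commuting with the star *)

Section PointwiseCurvature.
Variables (R : realType) (b : 'rV[R]_4 -> 'rV[R]_4 -> R).
Hypothesis bsym : forall u v, b u v = b v u.
Hypothesis blin : forall u (a : R) v w, b u (a *: v + w) = a * b u v + b u w.
Implicit Types (u v w x y : 'rV[R]_4) (xi eta : bivector R) (e : 'I_4 -> 'rV[R]_4).
Let ipE := ip2E bsym.

Section Operator.
Variable F : {linear bivector R -> bivector R}.
Definition op_form v w x y : R := ip2 b (F (wedge v w)) (wedge x y).
Local Notation q := op_form.

Lemma op_anti1 v w x y : q v w x y = - q w v x y.
Proof. by rewrite /q wedgeC linearN ipE. Qed.
Lemma op_anti2 v w x y : q v w x y = - q v w y x.
Proof. by rewrite /q [X in ip2 _ _ X]wedgeC ipE. Qed.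
Lemma op_lin1 a v v' w x y : q (a *: v + v') w x y = a * q v w x y + q v' w x y.
Proof. by rewrite /q wedge_linl linearP !ipE. Qed.
Lemma op_lin2 a v v' w x y : q w (a *: v + v') x y = a * q w v x y + q w v' x y.
Proof. by rewrite /q wedge_linr linearP !ipE. Qed.
Lemma op_lin3 a v v' w x y : q x y (a *: v + v') w = a * q x y v w + q x y v' w.
Proof. by rewrite /q wedge_linl !ipE. Qed.
Lemma op_lin4 a v v' w x y : q x y w (a *: v + v') = a * q x y w v + q x y w v'.
Proof. by rewrite /q wedge_linr !ipE. Qed.

Hypothesis bianchiF : algebraic_bianchi b F.

Let bianchi v w x y : q v w x y + q w x v y + q x v w y = 0.
Proof. exact: bianchiF. Qed.

Lemma op_sym v w x y : q v w x y = q x y v w.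
Proof. exact: (pair_symmetry op_anti1 op_anti2 bianchi). Qed.

Section InFrame.
Variable e : 'I_4 -> 'rV[R]_4.
Hypothesis fe : orthonormal_frame b e.
Local Notation r := (fun i j k l => q (e i) (e j) (e k) (e l)).

(** Self-adjointness is the pair symmetry of the curvature array, so it is a
    consequence of the Bianchi identity. *)
Lemma op_self_adjoint : self_adjoint b F.
Proof.
move=> xi eta; apply: (biv_ind bsym blin fe (P := fun xi => ip2 b (F xi) eta = ip2 b xi (F eta))) xi.
  by move=> a x y Hx Hy; rewrite linearP !ipE Hx Hy.
move=> i j; apply: (biv_ind bsym blin fe (P := fun eta => ip2 b (F (wedge (e i) (e j))) eta
   = ip2 b (wedge (e i) (e j)) (F eta))) eta.
  by move=> a x y Hx Hy; rewrite linearP !ipE Hx Hy.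
by move=> k l; rewrite [RHS](ip2_sym bsym); exact: op_sym.
Qed.

Definition plane_form d k d' k' : R := ip2 b (F (plane e d k)) (plane e d' k').
Local Notation m := plane_form.

Lemma plane_form_sym d k d' k' : m d k d' k' = m d' k' d k.
Proof. by rewrite /m op_self_adjoint (ip2_sym bsym). Qed.

Lemma dual_invariant_planes :
  dual_invariant r <-> forall d k d' k', m (~~ d) k (~~ d') k' = m d k d' k'.
Proof.
split.
  move=> [[h1 h2 h3] [[h4 h5 h6] [h7 h8 h9]]].
  have U k k' : m true k true k' = m false k false k'.
    move: k k'; do 2 (apply: ord3_ind);
     rewrite /m ?planeE; do ?[exact: h1|exact: h2|exact: h3|exact: h4|exact: h5|exact: h6];
     by rewrite op_self_adjoint (ip2_sym bsym) [RHS]op_self_adjoint [RHS](ip2_sym bsym).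
  have V k k' : m true k false k' = m false k true k'.
    move: k k'; do 2 (apply: ord3_ind);
     rewrite [LHS]/m [RHS]plane_form_sym /m ?planeE//;
     do ?[by rewrite [RHS]op_self_adjoint [RHS](ip2_sym bsym); first [exact: h7|exact: h8|exact: h9]
         |by rewrite op_self_adjoint (ip2_sym bsym); first [exact: esym h7|exact: esym h8|exact: esym h9]].
  by case=> k [] k'; rewrite /= ?U ?V// plane_form_sym V plane_form_sym.
move=> H.
have := (H false 0 false 0, H false 1 false 1, H false 2 false 2,
  (H false 0 false 1, H false 0 false 2, H false 1 false 2),
  (H false 0 true 1, H false 0 true 2, H false 1 true 2)).
rewrite /m /= !planeE => -[[[[[]]]]] h1 h2 h3 [[h4 h5] h6] [[h7 h8] h9].
by split; [|split]; split.
Qed.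

(** Part (a) at one point: in an orthonormal frame, commuting with the star and
    having a Ricci contraction proportional to the identity are both equivalent
    to the invariance of the curvature array under duality. *)
Lemma commute_iff_ricci (star : {linear bivector R -> bivector R}) :
  is_hodge_star b star ->
  (forall xi, F (star xi) = star (F xi)) <->
  exists f, forall j k, \sum_i q (e i) (e j) (e i) (e k) = f * (j == k)%:R.
Proof.
move=> hs; have [s s1 se] := star_frame bsym blin hs fe.
have a1 i j k l : r i j k l = - r j i k l by exact: op_anti1.
have a2 i j k l : r i j k l = - r i j l k by exact: op_anti2.
have a3 i j k l : r i j k l + r j k i l + r k i j l = 0 by exact: bianchi.
rewrite (commute_array bsym blin fe s1 se); split.
  move=> /dual_invariant_planes H.
  exists (q (e 0) (e 1) (e 0) (e 1) + q (e 0) (e 2) (e 0) (e 2) + q (e 0) (e 3) (e 0) (e 3)) => j k.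
  exact: (@ricci_of_dual _ r a1 a2 a3 H).
move=> [f H]; apply/dual_invariant_planes.
exact: (@dual_of_ricci _ r a1 a2 a3 f H).
Qed.
End InFrame.
End Operator.

Lemma bilinear_suml B (I : Type) (s : seq I) (c : I -> R) (u : I -> 'rV[R]_4) w :
  bilinear_form B -> B (\sum_(i <- s) c i *: u i) w = \sum_(i <- s) c i * B (u i) w.
Proof.
move=> [Bl _]; elim: s => [|i s IH]; last by rewrite !big_cons Bl IH.
by rewrite !big_nil; have := Bl (-1) 0 0 w; rewrite scaler0 addr0 mulN1r addNr.
Qed.

Lemma bilinear_sumr B (I : Type) (s : seq I) (c : I -> R) (u : I -> 'rV[R]_4) w :
  bilinear_form B -> B w (\sum_(i <- s) c i *: u i) = \sum_(i <- s) c i * B w (u i).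
Proof.
move=> [_ Br]; elim: s => [|i s IH]; last by rewrite !big_cons Br IH.
by rewrite !big_nil; have := Br (-1) 0 0 w; rewrite scaler0 addr0 mulN1r addNr.
Qed.

Lemma bilinear_frame B e x y : bilinear_form B -> orthonormal_frame b e ->
  B x y = \sum_i \sum_j b x (e i) * b y (e j) * B (e i) (e j).
Proof.
move=> hB fe; rewrite {1}(frame_expand bsym blin fe x) bilinear_suml//; apply: eq_bigr => i _.
rewrite {1}(frame_expand bsym blin fe y) bilinear_sumr// mulr_sumr; apply: eq_bigr => j _.
by rewrite mulrA.
Qed.

Lemma bilinear_frame_eq B e f : bilinear_form B -> orthonormal_frame b e ->
  (forall j k, B (e j) (e k) = f * (j == k)%:R) -> forall x y, B x y = f * b x y.
Proof.
move=> hB fe H x y; rewrite (bilinear_frame x y hB fe).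
have hb := form_bilinear bsym blin.
rewrite (bilinear_frame x y hb fe) mulr_sumr; apply: eq_bigr => i _.
rewrite mulr_sumr; apply: eq_bigr => j _; rewrite H fe; ring.
Qed.

(** If [E = A e] then the Gram matrix of [E] is [A A^T] and the matrix of [B] is
    multiplied in the same way, so the trace of [G^-1 S] is the trace of [B] in
    [e]. Hence the trace does not depend on [e], and it is a rational function of
    the data in any basis, in particular in a smooth local one. *)
Lemma trace_in_basis B e (E : 'I_4 -> 'rV[R]_4) : bilinear_form B -> orthonormal_frame b e ->
  let G := \matrix_(i, j) b (E i) (E j) in \det G != 0 ->
  \sum_i B (e i) (e i) = \tr (\adj G *m \matrix_(i, j) B (E i) (E j)) / \det G.
Proof.
move=> hB fe G G0; pose A : 'M[R]_4 := \matrix_(i, j) b (E i) (e j).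
pose S : 'M[R]_4 := \matrix_(i, j) B (e i) (e j).
have expand C : bilinear_form C ->
    \matrix_(i, j) C (E i) (E j) = A *m (\matrix_(i, j) C (e i) (e j)) *m A^T.
  move=> hC; apply/matrixP => i j; rewrite -mulmxA !mxE (bilinear_frame _ _ hC fe).
  apply: eq_bigr => k _; rewrite !mxE mulr_sumr; apply: eq_bigr => l _.
  by rewrite !mxE; ring.
have hb := form_bilinear bsym blin.
have GA : G = A *m A^T.
  rewrite /G (expand _ hb); congr (_ *m _); rewrite -[RHS]mulmx1; congr (_ *m _).
  by apply/matrixP => i j; rewrite !mxE fe.
have AX : A *m ((\det G)^-1 *: (A^T *m \adj G)) = 1%:M.
  rewrite -scalemxAr mulmxA -GA mul_mx_adj -mul_scalar_mx -scalar_mxM.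
  by rewrite mulVf.
have XA := mulmx1C AX.
rewrite (expand _ hB) -/S !mulmxA mxtrace_mulC !mulmxA.
have -> : A^T *m \adj G *m A = (\det G)%:M.
  move: XA; rewrite -scalemxAl => /(congr1 (fun Z => \det G *: Z)).
  by rewrite scalerA divff// scale1r => ->; rewrite scalemx1.
rewrite mul_scalar_mx mxtraceZ mulrC mulrA mulVf// mul1r.
by apply: eq_bigr => i _; rewrite mxE.
Qed.

End PointwiseCurvature.

(** * Diagonalisation in a frame of maximal value *)

Section MaximalFrame.
Variables (R : realType) (b : 'rV[R]_4 -> 'rV[R]_4 -> R).
Hypothesis bsym : forall u v, b u v = b v u.
Hypothesis blin : forall u (a : R) v w, b u (a *: v + w) = a * b u v + b u w.
Implicit Types (v w : 'rV[R]_4) (xi eta : bivector R) (e : 'I_4 -> 'rV[R]_4).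
Let ipE := ip2E bsym.
Variable F : {linear bivector R -> bivector R}.
Local Notation q := (op_form b F).

(** The weights 1, 2, 3 only have to be distinct: a rotation which mixes two of
    the planes through [e 0] then changes the value to first order unless the
    corresponding matrix entry vanishes. *)
Definition frame_value e : R := \sum_(k < 3) k.+1%:R * plane_form b F e false k false k.

Definition rotated_frame (u : 'I_4 -> 'rV[R]_4) (O : 'M[R]_4) i := \sum_j O i j *: u j.

Lemma rotated_frame_form u O i j : orthonormal_frame b u ->
  b (rotated_frame u O i) (rotated_frame u O j) = \sum_k O i k * O j k.
Proof.
move=> fu; rewrite /rotated_frame (bilinear_suml _ _ _ _ (form_bilinear bsym blin)).
apply: eq_bigr => k _; congr (_ * _).
rewrite (bilinear_sumr _ _ _ _ (form_bilinear bsym blin)) (bigD1 k)//= fu eqxx mulr1 big1 ?addr0//.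
by move=> l lk; rewrite fu eq_sym (negbTE lk) mulr0.
Qed.

Lemma op_form_sum (c1 c2 c3 c4 : 'I_4 -> R) (u : 'I_4 -> 'rV[R]_4) :
  q (\sum_i c1 i *: u i) (\sum_i c2 i *: u i) (\sum_i c3 i *: u i) (\sum_i c4 i *: u i)
  = \sum_i \sum_j \sum_k \sum_l c1 i * (c2 j * (c3 k * (c4 l * q (u i) (u j) (u k) (u l)))).
Proof.
have B12 x y : bilinear_form (fun v w => q v w x y).
  by split=> *; [rewrite op_lin1|rewrite op_lin2].
have B34 v w : bilinear_form (fun x y => q v w x y).
  by split=> *; [rewrite op_lin3|rewrite op_lin4].
rewrite (bilinear_suml _ _ _ _ (B12 _ _)); apply: eq_bigr => i _.
rewrite (bilinear_sumr _ _ _ _ (B12 _ _)) mulr_sumr; apply: eq_bigr => j _.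
rewrite (bilinear_suml _ _ _ _ (B34 _ _)) !mulr_sumr; apply: eq_bigr => k _.
by rewrite (bilinear_sumr _ _ _ _ (B34 _ _)) !mulr_sumr.
Qed.

(** The frames are the images of a fixed one under the compact group O(4), on
    which the value is a polynomial. *)
Lemma maximal_frame u : orthonormal_frame b u ->
  exists2 e, orthonormal_frame b e &
    forall e', orthonormal_frame b e' -> frame_value e' <= frame_value e.
Proof.
move=> fu.
pose O (v : 'rV[R]_(4 * 4)) : 'M[R]_4 := vec_mx v.
pose S : set 'rV[R]_(4 * 4) := [set v | forall i j, \sum_k O v i k * O v j k = (i == j)%:R].
have cO i j : Ck 0 setT (fun v : 'rV[R]_(4 * 4) => O v i j).
  have := @Ck_proj R 0 (4 * 4) setT (mxvec_index i j) (@openT _).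
  by congr Ck; apply/funext => v; rewrite /O mxE.
have cont (f : 'rV[R]_(4 * 4) -> R) : Ck 0 setT f -> continuous f by move=> C v; exact: C.
have S1 : S !=set0.
  exists (mxvec 1%:M) => i j; rewrite /O mxvecK (bigD1 i)//= !mxE eqxx mul1r.
  rewrite big1 ?addr0 1?eq_sym// => k ki.
  by rewrite mxE eq_sym (negbTE ki) mul0r.
have Scl : closed S.
  have -> : S = \bigcap_(ij in [set: 'I_4 * 'I_4])
      ((fun v : 'rV[R]_(4 * 4) => \sum_k O v ij.1 k * O v ij.2 k) @^-1` [set x | x = (ij.1 == ij.2)%:R]).
    apply/seteqP; split=> v /= H; first by move=> [i j] _; exact: H.
    by move=> i j; exact: (H (i, j)).
  apply: closed_bigI => -[i j] _.
  apply: (continuous_closedP _).1; last exact: closed_eq.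
  by apply: cont; apply: Ck_sum => [|k _]; [exact: openT|apply: CkM => //; exact: openT].
have Sb : bounded_set S.
  exists 1; split; first exact: num_real.
  move=> M M1 v Sv; apply: le_trans (ltW M1).
  rewrite /Num.Def.normr /= mx_normrE; apply: bigmax_le => // -[i k] _.
  rewrite ord1 /=; case/mxvec_indexP: k => i' j'.
  have -> : v 0 (mxvec_index i' j') = O v i' j' by rewrite /O mxE.
  rewrite -ler_sqr ?nnegrE// expr1n real_normK ?num_real//.
  have E1 : \sum_k O v i' k * O v i' k = 1 by rewrite (Sv i' i') eqxx.
  rewrite -[leRHS]E1 (bigD1 j')//= -expr2 lerDl sumr_ge0// => k _.
  by rewrite -expr2 sqr_ge0.
have cS : compact S by exact: bounded_closed_compact.
pose phi (v : 'rV[R]_(4 * 4)) := frame_value (rotated_frame u (O v)).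
have cphi : continuous phi.
  apply: cont; apply: Ck_sum => [|k _]; first exact: openT.
  apply: CkM; [exact: openT|exact: Ck_cst|].
  rewrite (_ : (fun _ => _) = fun v : 'rV[R]_(4 * 4) =>
     \sum_i \sum_j \sum_l \sum_m O v 0 i * (O v (lift ord0 k) j * (O v 0 l * (O v (lift ord0 k) m *
       q (u i) (u j) (u l) (u m))))).
    do 4 (apply: Ck_sum => [|? _]; first exact: openT).
    do 4 (apply: CkM; [exact: openT|exact: cO|]).
    exact: Ck_cst.
  by apply/funext => v; exact: op_form_sum.
have [v Sv vmax] := EVT_max_rV S1 cS (continuous_subspaceT cphi).
rewrite inE in Sv.
exists (rotated_frame u (O v)); first by move=> i j; rewrite rotated_frame_form.
move=> e' fe'.
pose O' : 'M[R]_4 := \matrix_(i, j) b (e' i) (u j).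
have e'E i : rotated_frame u O' i = e' i.
  by rewrite [RHS](frame_expand bsym blin fu); apply: eq_bigr => j _; rewrite mxE.
have OO' : O (mxvec O') = O' by rewrite /O mxvecK.
have -> : e' = rotated_frame u (O (mxvec O')) by apply/funext => i; rewrite OO' e'E.
by apply: vmax; rewrite inE => i j; rewrite OO' -(rotated_frame_form _ _ _ fu) !e'E fe'.
Qed.

(** Along a circle, a quadratic form with a maximum at [(1, 0)] has no mixed
    term; by homogeneity the inequality extends to the whole plane. *)
Lemma max_first_variation (al be : R) :
  (forall c s, c ^+ 2 + s ^+ 2 = 1 -> s ^+ 2 * al + 2 * c * s * be <= 0) -> be = 0.
Proof.
move=> H.
have H2 (x y : R) : y ^+ 2 * al + 2 * x * y * be <= 0.
  have [/eqP z|nz] := boolP (x ^+ 2 + y ^+ 2 == 0).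
    have x0 : x ^+ 2 = 0 by have := sqr_ge0 x; have := sqr_ge0 y; lra.
    have y0 : y ^+ 2 = 0 by have := sqr_ge0 x; have := sqr_ge0 y; lra.
    move/eqP: y0; rewrite sqrf_eq0 => /eqP ->; lra.
  have N0 : 0 < x ^+ 2 + y ^+ 2 by rewrite lt_def nz addr_ge0 ?sqr_ge0.
  set N := x ^+ 2 + y ^+ 2 in N0 *.
  have sN : Num.sqrt N ^+ 2 = N by rewrite sqr_sqrtr// ltW.
  have sN0 : Num.sqrt N != 0 by rewrite sqrtr_eq0 -ltNge.
  have := H (x / Num.sqrt N) (y / Num.sqrt N).
  rewrite !expr_div_n sN -mulrDl divff ?gt_eqF// => /(_ erefl).
  have -> : y ^+ 2 / N * al + 2 * (x / Num.sqrt N) * (y / Num.sqrt N) * be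
     = (y ^+ 2 * al + 2 * x * y * be) / N.
    by move: sN sN0; move: (Num.sqrt N) => r <- r0; field.
  by rewrite pmulr_lle0// invr_gt0.
have [//|nz] := eqVneq be 0.
have b2 : 0 < be ^+ 2 by rewrite lt_def sqrf_eq0 nz sqr_ge0.
have := H2 (`|al| + 1) be; have := ler_norm (- al); rewrite normrN => h1.
have h2 := normr_ge0 al.
nra.
Qed.

Hypothesis bianchiF : algebraic_bianchi b F.

Section Rotations.
Variable e : 'I_4 -> 'rV[R]_4.
Hypothesis fe : orthonormal_frame b e.
Hypothesis emax : forall e', orthonormal_frame b e' -> frame_value e' <= frame_value e.
Let sa := op_self_adjoint bsym blin bianchiF fe.
Local Notation m := (plane_form b F e).

Definition plane_rotation (i j : 'I_4) (c s : R) (l : 'I_4) : 'rV[R]_4 :=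
  if l == i then c *: e i + s *: e j else if l == j then - s *: e i + c *: e j else e l.

Lemma plane_rotation_frame i j c s : i != j -> c ^+ 2 + s ^+ 2 = 1 ->
  orthonormal_frame b (plane_rotation i j c s).
Proof.
move=> ij cs k l; rewrite /plane_rotation.
have ji : j != i by rewrite eq_sym.
have fE := (formDl bsym blin, formZl bsym blin, formNl bsym blin, formDr blin, formZr blin, formNr blin).
case: (eqVneq k i) => [Ek|ki]; [|case: (eqVneq k j) => [Ek|kj]];
 (case: (eqVneq l i) => [El|li]; [|case: (eqVneq l j) => [El|lj]]);
 rewrite ?Ek ?El ?fE ?fe ?eqxx ?(negbTE ij) ?(negbTE ji) ?[i == l]eq_sym ?[j == l]eq_sym
   ?(negbTE ki) ?(negbTE kj) ?(negbTE li) ?(negbTE lj) /= ?(mulr0, mulr1, addr0, add0r)//;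
 rewrite -?cs; ring.
Qed.

Hypothesis dual : forall d k d' k', m (~~ d) k (~~ d') k' = m d k d' k'.
Let msym := plane_form_sym bsym blin bianchiF fe.

(** The rotation moves the planes [a] and [a'] through [e 0] towards
    [plane e d a'] and [- plane e d a]. By the symmetries of [m] their cross terms
    are opposite, so the first variation of the value is twice the difference of
    their weights times [m false a d a']. *)
Lemma rotation_vanish i j (a a' : 'I_3) d : i != j -> a != a' ->
  (forall c s, plane (plane_rotation i j c s) false a = c *: plane e false a + s *: plane e d a') ->
  (forall c s, plane (plane_rotation i j c s) false a' = c *: plane e false a' - s *: plane e d a) ->
  (forall c s k, c ^+ 2 + s ^+ 2 = 1 -> k != a -> k != a' ->
     plane (plane_rotation i j c s) false k = plane e false k) ->
  m false a d a' = 0.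
Proof.
move=> ij aa' Ha Ha' Hk.
set Qa := plane e d a' in Ha *; pose Qa' := - plane e d a.
have {}Ha' c s : plane (plane_rotation i j c s) false a' = c *: plane e false a' + s *: Qa'.
  by rewrite Ha' scalerN.
have mdd k : m d k d k = m false k false k by case: (d) => //; rewrite (dual false k false k).
have Q1 : ip2 b (F Qa) Qa = m false a' false a' by exact: mdd.
have Q2 : ip2 b (F Qa') Qa' = m false a false a.
  by rewrite linearN /= !ipE opprK; exact: mdd.
have Q3 : ip2 b (F (plane e false a')) Qa' = - ip2 b (F (plane e false a)) Qa.
  rewrite !ipE; congr (- _); rewrite -![ip2 b (F _) _]/(m _ _ _ _) msym.
  by rewrite /Qa; case: (d) => //; rewrite -(dual false a true a') /= msym.
rewrite -[LHS]/(ip2 b (F (plane e false a)) Qa).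
have quad2 c s P Q : ip2 b (F (c *: P + s *: Q)) (c *: P + s *: Q) =
    c ^+ 2 * ip2 b (F P) P + 2 * c * s * ip2 b (F P) Q + s ^+ 2 * ip2 b (F Q) Q.
  rewrite linearD !linearZ /= !ipE.
  have -> : ip2 b (F Q) P = ip2 b (F P) Q by rewrite sa ip2_sym.
  ring.
pose t : R := (a.+1)%:R - (a'.+1)%:R.
have t0 : t != 0.
  rewrite /t subr_eq0 eqr_nat eqSS; exact: aa'.
suff : t * ip2 b (F (plane e false a)) Qa = 0.
  by move/eqP; rewrite mulf_eq0 (negbTE t0) => /eqP.
apply: (@max_first_variation (t * (m false a' false a' - m false a false a))) => c s cs.
have := emax (plane_rotation_frame ij cs); rewrite /frame_value.
rewrite (bigD1 a)//= (bigD1 a')//=; last by rewrite eq_sym.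
rewrite [X in _ <= X](bigD1 a)//= [X in _ <= _ + X](bigD1 a')//=; last by rewrite eq_sym.
rewrite [X in _ + (_ + X) <= _](eq_bigr (fun k : 'I_3 => k.+1%:R * m false k false k)); last first.
  by move=> k /andP[ka ka']; rewrite /plane_form Hk.
rewrite !addrA lerD2r.
rewrite {1 2}/plane_form Ha Ha' !quad2 Q1 Q2 Q3.
rewrite -[ip2 b (F (plane e false a)) (plane e false a)]/(m false a false a).
rewrite -[ip2 b (F (plane e false a')) (plane e false a')]/(m false a' false a').
have c2 : c ^+ 2 = 1 - s ^+ 2 by rewrite -cs addrK.
rewrite c2 /t.
move: (a.+1%:R : R) (a'.+1%:R : R) (ip2 b _ Qa) (m _ a _ a) (m _ a' _ a') => n1 n2 z m1 m2 H.
lra.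
Qed.

(** The three rotations fixing [e 0] make the block of the planes through [e 0]
    diagonal; the three rotations moving [e 0] do the same for its block with the
    dual planes. *)
Lemma maximal_frame_normal d k d' k' : k != k' -> m d k d' k' = 0.
Proof.
suff [A B] : [/\ m false 0 false 1 = 0, m false 0 false 2 = 0 & m false 1 false 2 = 0] /\
  [/\ m false 0 true 1 = 0, m false 0 true 2 = 0 & m false 1 true 2 = 0].
  have [A1 A2 A3] := A; have [B1 B2 B3] := B.
  have A' i j : i != j -> m false i false j = 0.
    by move: i j; do 2 (apply: ord3_ind => //); rewrite // msym.
  have B' i j : i != j -> m false i true j = 0.
    by move: i j; do 2 (apply: ord3_ind => //); rewrite // -dual msym.
  case: d; case: d' => kk.
  - by rewrite (dual false k false k') A'.
  - by rewrite (dual false k true k') B'.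
  - exact: B'.
  - exact: A'.
split; split.
- apply: (@rotation_vanish 1 2 0 1 false) => //.
  + by move=> c s; rewrite !planeE /plane_rotation /=; apply: bivP => i j; rewrite !bivE !mxE; ring.
  + by move=> c s; rewrite !planeE /plane_rotation /=; apply: bivP => i j; rewrite !bivE !mxE; ring.
  + by move=> c s; apply: ord3_ind => //; rewrite !planeE /plane_rotation.
- apply: (@rotation_vanish 1 3 0 2 false) => //.
  + by move=> c s; rewrite !planeE /plane_rotation /=; apply: bivP => i j; rewrite !bivE !mxE; ring.
  + by move=> c s; rewrite !planeE /plane_rotation /=; apply: bivP => i j; rewrite !bivE !mxE; ring.
  + by move=> c s; apply: ord3_ind => //; rewrite !planeE /plane_rotation.
- apply: (@rotation_vanish 2 3 1 2 false) => //.
  + by move=> c s; rewrite !planeE /plane_rotation /=; apply: bivP => i j; rewrite !bivE !mxE; ring.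
  + by move=> c s; rewrite !planeE /plane_rotation /=; apply: bivP => i j; rewrite !bivE !mxE; ring.
  + by move=> c s; apply: ord3_ind => //; rewrite !planeE /plane_rotation.
- apply: (@rotation_vanish 0 3 0 1 true) => //.
  + by move=> c s; rewrite !planeE /plane_rotation /=; apply: bivP => i j; rewrite !bivE !mxE; ring.
  + by move=> c s; rewrite !planeE /plane_rotation /=; apply: bivP => i j; rewrite !bivE !mxE; ring.
  + move=> c s; apply: ord3_ind => // cs _ _; rewrite -[RHS]scale1r -cs !planeE /plane_rotation /=.
    by apply: bivP => i j; rewrite !bivE !mxE; ring.
- apply: (@rotation_vanish 2 0 0 2 true) => //.
  + by move=> c s; rewrite !planeE /plane_rotation /=; apply: bivP => i j; rewrite !bivE !mxE; ring.
  + by move=> c s; rewrite !planeE /plane_rotation /=; apply: bivP => i j; rewrite !bivE !mxE; ring.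
  + move=> c s; apply: ord3_ind => // cs _ _; rewrite -[RHS]scale1r -cs !planeE /plane_rotation /=.
    by apply: bivP => i j; rewrite !bivE !mxE; ring.
- apply: (@rotation_vanish 0 1 1 2 true) => //.
  + by move=> c s; rewrite !planeE /plane_rotation /=; apply: bivP => i j; rewrite !bivE !mxE; ring.
  + by move=> c s; rewrite !planeE /plane_rotation /=; apply: bivP => i j; rewrite !bivE !mxE; ring.
  + move=> c s; apply: ord3_ind => // cs _ _; rewrite -[RHS]scale1r -cs !planeE /plane_rotation /=.
    by apply: bivP => i j; rewrite !bivE !mxE; ring.
Qed.
End Rotations.
End MaximalFrame.

(** * Critical points and the normal form *)

Section Critical.
Variables (R : realType) (b : 'rV[R]_4 -> 'rV[R]_4 -> R).
Hypothesis bsym : forall u v, b u v = b v u.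
Hypothesis blin : forall u (a : R) v w, b u (a *: v + w) = a * b u v + b u w.
Implicit Types (u v w : 'rV[R]_4) (e : 'I_4 -> 'rV[R]_4).
Let ipE := ip2E bsym.

Lemma Ck_cos_sin k : Ck k setT (@cos R) /\ Ck k setT (@sin R).
Proof.
have dc t : differentiable (@cos R) t by apply/derivable1_diffP; have [] := is_derive_cos t.
have ds t : differentiable (@sin R) t by apply/derivable1_diffP; have [] := is_derive_sin t.
elim: k => [|k [IHc IHs]].
  by split=> t _; exact: differentiable_continuous.
split; split=> [t _//|v].
- have -> : 'D_v (@cos R) = fun t => v *: (- sin t).
    by apply/funext => t; rewrite derive_scale//; have [_ ->] := is_derive_cos t.
  by apply: CkZ; [exact: openT|apply: CkN; [exact: openT|]].
- have -> : 'D_v (@sin R) = fun t => v *: cos t.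
    by apply/funext => t; rewrite derive_scale//; have [_ ->] := is_derive_sin t.
  by apply: CkZ; [exact: openT|].
Qed.

(** The derivative of the quadratic form along the curve
    [v /\ (cos t w + sin t u)] is twice this inner product. *)
Lemma critical_orthogonal (F : {linear bivector R -> bivector R}) v w u :
  self_adjoint b F -> b v v = 1 -> b w w = 1 -> b u u = 1 ->
  b v w = 0 -> b v u = 0 -> b w u = 0 ->
  critical_point b F (wedge v w) -> ip2 b (F (wedge v w)) (wedge v u) = 0.
Proof.
move=> sa vv ww uu vw vu wu [_ crit].
pose c (t : R) := wedge v (cos t *: w + sin t *: u).
have cE t : c t = cos t *: wedge v w + sin t *: wedge v u.
  by apply: bivP => i j; rewrite !bivE !mxE; ring.
have c0 : c 0 = wedge v w by rewrite cE cos0 sin0 scale1r scale0r addr0.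
have sm : smooth_on [set: R] (fun t => bivector_val (c t)).
  move=> k; have [Cc Cs] := Ck_cos_sin k.
  have oT := @openT R.
  have C := CkD oT (CkZl (bivector_val (wedge v w)) oT Cc) (CkZl (bivector_val (wedge v u)) oT Cs).
  apply: Ck_ext oT _ C => t _.
  by apply/matrixP => i j; rewrite cE [RHS]bivD !bivZ !mxE.
have gr t : grassmannian b (c t).
  split; first by exists v, (cos t *: w + sin t *: u).
  rewrite ip2_wedge// vv !(formDr blin) !(formZr blin) !(formDl bsym blin) !(formZl bsym blin).
  rewrite (bsym w v) (bsym u v) (bsym u w) ww uu vw vu wu.
  by rewrite -[RHS](cos2Dsin2 t); ring.
have D := crit c sm gr c0.
set z := ip2 b _ _.
pose qw := ip2 b (F (wedge v w)) (wedge v w).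
pose qu := ip2 b (F (wedge v u)) (wedge v u).
pose f t : R := cos t * cos t * qw + cos t * sin t * (2 * z) + sin t * sin t * qu.
have qE : (fun t => quad b F (c t)) = f.
  apply/funext => t; rewrite /quad cE linearD !linearZ /= !ipE /f /z /qw /qu.
  have -> : ip2 b (F (wedge v u)) (wedge v w) = ip2 b (F (wedge v w)) (wedge v u).
    by rewrite sa ip2_sym.
  ring.
rewrite qE in D.
have dcos := is_derive_cos (0 : R); have dsin := is_derive_sin (0 : R).
have D2 : is_derive (0 : R) (1 : R) f (2 * z).
  have dcst (a : R) : is_derive (0 : R) (1 : R) (cst a : R -> R) 0 by exact: is_derive_cst.
  have E := is_deriveD (is_deriveD (is_deriveM (is_deriveM dcos dcos) (dcst qw))
     (is_deriveM (is_deriveM dcos dsin) (dcst (2 * z))))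
     (is_deriveM (is_deriveM dsin dsin) (dcst qu)).
  refine (is_derive_eq E _).
  by rewrite /GRing.scale /= !fctE cos0 sin0; ring.
case: D => _; case: D2 => _ -> z0.
lra.
Qed.

Lemma ip2_suml (I : Type) (s : seq I) (x : I -> bivector R) y :
  ip2 b (\sum_(i <- s) x i) y = \sum_(i <- s) ip2 b (x i) y.
Proof. by elim: s => [|i s IH]; rewrite ?big_nil ?ipE// !big_cons ipE IH. Qed.

Lemma is_derive_sum0 n (h : 'I_n -> R -> R) (x : R) :
  (forall i, is_derive x (1 : R) (h i) 0) -> is_derive x (1 : R) (fun t => \sum_i h i t) 0.
Proof.
move=> H; have D : is_derive x (1 : R) (\sum_i h i) 0.
  by refine (is_derive_eq (is_derive_sum H) _); rewrite big1.
have -> : (fun t => \sum_i h i t) = \sum_i h i; last exact: D.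
by apply/funext => t; rewrite fct_sumE.
Qed.

(** A quadratic form of a curve through [0] vanishes to second order. *)
Lemma quad_derive0 (A : {linear bivector R -> bivector R}) (c : R -> bivector R) P :
  smooth_on [set: R] (fun t => bivector_val (c t)) -> c 0 = P ->
  is_derive (0 : R) (1 : R) (fun t => quad b A (c t - P)) 0.
Proof.
move=> sm c0.
pose d i j (t : R) : R := bivector_val (c t) i j - bivector_val P i j.
have d0 i j : d i j 0 = 0 by rewrite /d c0 subrr.
have dd i j : derivable (d i j) 0 1.
  have D : differentiable (fun t => bivector_val (c t)) 0 by exact: Ck_diff (sm 1%N) _.
  have Dm := (derivable_mxP (fun t => bivector_val (c t)) 0 1).1 (diff_derivable D) i j.
  exact: (derivableB Dm (derivable_cst (bivector_val P i j) _ _)).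
pose K i j k l : R := 2^-1 * (2^-1 * ip2 b (A (wedge (delta_mx 0 i) (delta_mx 0 j)))
  (wedge (delta_mx 0 k) (delta_mx 0 l))).
have -> : (fun t => quad b A (c t - P)) =
    fun t => \sum_i \sum_j \sum_k \sum_l d i j t * (d k l t * K i j k l).
  apply/funext => t; rewrite /quad.
  have xE i j : bivector_val (c t - P) i j = d i j t by rewrite bivD bivN.
  rewrite {1}(wedge_sum_delta (c t - P)) linear_sum ip2_suml; apply: eq_bigr => i _.
  rewrite linear_sum ip2_suml; apply: eq_bigr => j _.
  rewrite linearZ /= ip2Zl xE (ip2_sym bsym) (wedge_sum_delta (c t - P)) ip2_suml mulr_sumr.
  apply: eq_bigr => k _; rewrite ip2_suml mulr_sumr; apply: eq_bigr => l _.
  by rewrite ip2Zl xE (ip2_sym bsym) /K; ring.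
apply: is_derive_sum0 => i; apply: is_derive_sum0 => j.
apply: is_derive_sum0 => k; apply: is_derive_sum0 => l.
have E := is_deriveM (derivableP (dd i j))
  (is_deriveM (derivableP (dd k l)) (is_derive_cst (K i j k l) (0 : R) (1 : R))).
refine (is_derive_eq E _).
by rewrite /GRing.scale /= !fctE !d0; ring.
Qed.

Variables (star : {linear bivector R -> bivector R}).
Hypothesis hs : is_hodge_star b star.
Variables (e : 'I_4 -> 'rV[R]_4).
Hypothesis fe : orthonormal_frame b e.

(** Up to a positive factor this is [P /\ P], which vanishes for decomposable
    [P]; unit decomposable bivectors are thus orthogonal to their dual. *)
Lemma star_wedge_self v w : ip2 b (star (wedge v w)) (wedge v w) = 0.
Proof.
have [s s1 se] := star_frame bsym blin hs fe.
have [f ff f0] := positive_frame bsym blin fe.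
have := hs ff f0 (wedge v w) (star (wedge v w)).
rewrite (star_star bsym blin fe s1 se) ip2_sym// wedge22_explicit => /esym E.
by apply: (mulIf (lt0r_neq0 f0)); rewrite E mul0r; ring.
Qed.

(** On the Grassmannian [<Q, Q> = 1] and [<star Q, Q> = 0], so
    [<F Q, Q>] differs from [al] by a quadratic form in [Q - P]: the linear terms
    [al <P, Q - P>] and [be <star P, Q - P>] are themselves quadratic in [Q - P]. *)
Lemma critical_of_eigen (F : {linear bivector R -> bivector R}) P (al be : R) :
  self_adjoint b F -> grassmannian b P -> F P = al *: P + be *: star P ->
  critical_point b F P.
Proof.
move=> sa gP FP; split=> // c sm gc c0.
have [s s1 se] := star_frame bsym blin hs fe.
have ssym := star_sym bsym blin fe se.
have starP Q : grassmannian b Q -> ip2 b (star Q) Q = 0.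
  by move=> [[v [w ->]] _]; exact: star_wedge_self.
have qE t : quad b F (c t) = al + quad b F (c t - P) - al * quad b id (c t - P)
   - be * quad b star (c t - P).
  have c1 : ip2 b (c t) (c t) = 1 by case: (gc t).
  have P1 : ip2 b P P = 1 by case: gP.
  have sc := starP _ (gc t); have sP := starP _ gP.
  rewrite /quad !linearB /= !ipE.
  have E1 : ip2 b (F (c t)) P = ip2 b (F P) (c t) by rewrite sa ip2_sym.
  have E2 : ip2 b (star (c t)) P = ip2 b (star P) (c t) by rewrite ssym ip2_sym.
  rewrite E1 E2 FP !ipE c1 P1 sc sP (ip2_sym bsym (c t) P); ring.
have D1 := quad_derive0 F sm c0; have D2 := quad_derive0 star sm c0.
have D3 := quad_derive0 (idfun : {linear bivector R -> bivector R}) sm c0.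
rewrite (_ : (fun t => quad b F (c t)) = (fun t => al + quad b F (c t - P) - al * quad b id (c t - P)
   - be * quad b star (c t - P))); last by apply/funext => t; exact: qE.
have dcst (a : R) : is_derive (0 : R) (1 : R) (cst a : R -> R) 0 by exact: is_derive_cst.
have E := is_deriveB (is_deriveB (is_deriveD (dcst al) D1) (is_deriveM (dcst al) D3))
   (is_deriveM (dcst be) D2).
refine (is_derive_eq E _).
by rewrite /GRing.scale /= ?fctE; ring.
Qed.

End Critical.

Section NormalForm.
Variables (R : realType) (b : 'rV[R]_4 -> 'rV[R]_4 -> R).
Hypothesis bsym : forall u v, b u v = b v u.
Hypothesis blin : forall u (a : R) v w, b u (a *: v + w) = a * b u v + b u w.
Let ipE := ip2E bsym.
Variables (star : {linear bivector R -> bivector R}).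
Hypothesis hs : is_hodge_star b star.

(** [F] preserves the span of each plane [plane e false k] and its dual. *)
Definition normal_frame (F : {linear bivector R -> bivector R}) e :=
  forall d k d' k', k != k' -> plane_form b F e d k d' k' = 0.

Lemma normal_frame_exists (F : {linear bivector R -> bivector R}) u :
  orthonormal_frame b u -> algebraic_bianchi b F ->
  (forall xi, F (star xi) = star (F xi)) ->
  exists2 e, orthonormal_frame b e & normal_frame F e.
Proof.
move=> fu bF comm; have [e fe emax] := maximal_frame bsym blin F fu.
exists e => // d k d' k' kk.
have [s s1 se] := star_frame bsym blin hs fe.
apply: (maximal_frame_normal bsym blin bF fe emax) => //.
exact: (commute_array bsym blin fe s1 se F).1 comm.
Qed.

Variable e : 'I_4 -> 'rV[R]_4.
Hypothesis fe : orthonormal_frame b e.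

Section Commuting.
Variable F : {linear bivector R -> bivector R}.
Hypothesis bF : algebraic_bianchi b F.
Hypothesis comm : forall xi, F (star xi) = star (F xi).
Local Notation m := (plane_form b F e).

Lemma plane_form_dual d k d' k' : m (~~ d) k (~~ d') k' = m d k d' k'.
Proof.
have [s s1 se] := star_frame bsym blin hs fe.
exact: ((commute_array bsym blin fe s1 se F).1 comm).
Qed.

Lemma plane_form_swap d d' k k' : m d k d' k' = m false k (d (+) d') k'.
Proof. by case: d => //; rewrite -plane_form_dual. Qed.

Lemma normal_frame_eigen d k : normal_frame F e ->
  F (plane e d k) = m false k false k *: plane e d k + m false k true k *: plane e (~~ d) k.
Proof.
move=> nF; apply: (plane_eq bsym blin fe) => d' k'.
rewrite !ipE !(ip2_plane bsym blin fe) -[LHS]/(m d k d' k').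
have [<-|kk] := eqVneq k k'; last by rewrite nF// !andbF !mulr0 addr0.
by rewrite plane_form_swap !andbT; case: d; case: d' => /=; rewrite !(mulr0, mulr1) ?addr0 ?add0r.
Qed.

(** The Bianchi identity says that the entries pairing dual planes have
    vanishing sum. *)
Lemma plane_form_bianchi : m false 0 true 0 + m false 1 true 1 + m false 2 true 2 = 0.
Proof.
have := bF (e 1) (e 2) (e 3) (e 0).
rewrite ![wedge _ (e 0)]wedgeC !ipE -!planeE.
have A k : m false k true k = m true k false k by rewrite (plane_form_swap true).
by rewrite !A /plane_form => H; lra.
Qed.

Lemma plane_form_self_adjoint : self_adjoint b F.
Proof. exact: (op_self_adjoint bsym blin bF fe). Qed.

Lemma plane_grassmannian d k : grassmannian b (plane e d k).
Proof.
split; last by rewrite (ip2_plane bsym blin fe) !eqxx.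
move: k; case: d; apply: ord3_ind; rewrite planeE; by do 2 eexists.
Qed.

Lemma normal_frame_critical d k : normal_frame F e -> critical_point b F (plane e d k).
Proof.
move=> nF; have [s s1 se] := star_frame bsym blin hs fe.
apply: (critical_of_eigen bsym blin hs fe (al := m false k false k) (be := s * m false k true k)).
- exact: plane_form_self_adjoint.
- exact: plane_grassmannian.
- rewrite normal_frame_eigen// (star_plane se) scalerA mulrAC s1 mul1r//.
Qed.

(** The self-dual part (for a positive frame) of the plane 0 plus the
    anti-self-dual part of the plane [k]: both parts are eigenvectors of an
    operator in normal form, which makes the sum critical, and its value compares
    the entries pairing dual planes for the indices 0 and [k]. *)
Definition mixed_plane (k : 'I_3) : bivector R :=
  2^-1 *: (plane e false 0 + plane e true 0 + plane e false k - plane e true k).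

Lemma mixed_plane_grassmannian k : k != 0 -> grassmannian b (mixed_plane k).
Proof.
move=> k0; split.
  move: k k0; apply: ord3_ind => // _.
    (* k = 1: e01 + e23 + e02 - e31 = (e0 - e3) /\ (e1 + e2) *)
    exists (2^-1 *: (e 0 - e 3)), (e 1 + e 2); rewrite /mixed_plane !planeE.
    by apply: bivP => i j; rewrite !bivE !mxE; ring.
  (* k = 2: e01 + e23 + e03 - e12 = (e0 + e2) /\ (e1 + e3) *)
  exists (2^-1 *: (e 0 + e 2)), (e 1 + e 3); rewrite /mixed_plane !planeE.
  by apply: bivP => i j; rewrite !bivE !mxE; ring.
rewrite /mixed_plane !ipE !(ip2_plane bsym blin fe) !eqxx /= ![0 == k]eq_sym (negbTE k0) /=.
by field.
Qed.

Lemma mixed_plane_eigen k : k != 0 -> normal_frame F e ->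
  exists be, F (mixed_plane k) =
    ((m false 0 false 0 + m false 0 true 0 + (m false k false k - m false k true k)) / 2)
      *: mixed_plane k + be *: star (mixed_plane k).
Proof.
move=> k0 nF; have [s s1 se] := star_frame bsym blin hs fe.
set x := _ + m false 0 true 0; set y := _ - m false k true k.
exists (s * ((x - y) / 2)).
have sQ : s *: star (mixed_plane k)
    = 2^-1 *: (plane e true 0 + plane e false 0 + plane e true k - plane e false k).
  rewrite /mixed_plane linearZ /= linearB !linearD /= !(star_plane se) /=.
  apply: bivP => i j; rewrite !(bivD, bivZ, bivN).
  set A := bivector_val _ i j; set B := bivector_val _ i j.
  set C := bivector_val _ i j; set D := bivector_val _ i j.
  transitivity (s * s * (2^-1 * (A + B + C - D))); first ring.
  by rewrite s1 mul1r; ring.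
rewrite [s * _]mulrC -[X in _ + X]scalerA sQ /mixed_plane linearZ /= linearB !linearD /=.
rewrite !normal_frame_eigen//=.
rewrite /x /y; move: (m false 0 false 0) (m false 0 true 0) (m false k false k) (m false k true k).
move: (plane e false 0) (plane e true 0) (plane e false k) (plane e true k) => *.
by apply: bivP => i j; rewrite !(bivD, bivZ, bivN); field.
Qed.

Lemma mixed_plane_critical k : k != 0 -> normal_frame F e -> critical_point b F (mixed_plane k).
Proof.
move=> k0 nF; have [be E] := mixed_plane_eigen k0 nF.
apply: (critical_of_eigen bsym blin hs fe _ _ E).
  exact: plane_form_self_adjoint.
exact: mixed_plane_grassmannian.
Qed.

Lemma quad_mixed_plane k : k != 0 -> normal_frame F e ->
  quad b F (mixed_plane k) =
    (m false 0 false 0 + m false 0 true 0 + (m false k false k - m false k true k)) / 2.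
Proof.
move=> k0 nF; have [be E] := mixed_plane_eigen k0 nF.
have [[v [w Q]] Q1] := mixed_plane_grassmannian k0.
rewrite /quad E; rewrite Q in Q1 *.
rewrite !(ip2Dl, ip2Zl) Q1 (star_wedge_self bsym blin hs fe).
by rewrite mulr0 addr0 mulr1.
Qed.

End Commuting.

(** The unit vectors [e_j /\ e_l] sharing exactly one vector with [e_0 /\ e_k] are
    the velocities of rotations of that plane; the remaining planes are itself
    and its dual. *)
Lemma critical_plane_orthogonal (F : {linear bivector R -> bivector R}) k d' k' :
  self_adjoint b F -> k != k' -> critical_point b F (plane e false k) ->
  plane_form b F e false k d' k' = 0.
Proof.
move=> sa kk crit.
have fE := (formDl bsym blin, formZl bsym blin, formNl bsym blin, formDr blin, formZr blin, formNr blin).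
have wN v w : wedge v (- w) = - wedge v w.
  by apply: bivP => i j; rewrite !bivE !mxE; ring.
have H1 j l : j != 0 -> l != 0 -> j != l -> critical_point b F (wedge (e 0) (e j)) ->
    ip2 b (F (wedge (e 0) (e j))) (wedge (e 0) (e l)) = 0.
  move=> j0 l0 jl; apply: (critical_orthogonal bsym blin) => //;
    by rewrite fe ?eqxx// ?(negbTE jl)// eq_sym ?(negbTE j0) ?(negbTE l0).
have H2 j l : j != 0 -> l != 0 -> j != l -> critical_point b F (wedge (e 0) (e j)) ->
    ip2 b (F (wedge (e 0) (e j))) (wedge (e j) (e l)) = 0.
  move=> j0 l0 jl; have -> : wedge (e 0) (e j) = wedge (e j) (- e 0) by rewrite wN -wedgeC.
  apply: (critical_orthogonal bsym blin) => //;
    by rewrite ?fE ?opprK !fe ?eqxx// ?(negbTE jl)// ?(negbTE j0) ?oppr0// eq_sym (negbTE l0) oppr0.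
have H3 j l : j != 0 -> l != 0 -> j != l -> critical_point b F (wedge (e 0) (e j)) ->
    ip2 b (F (wedge (e 0) (e j))) (wedge (e l) (e j)) = 0.
  by move=> j0 l0 jl cr; rewrite (wedgeC (e l)) ipE H2// oppr0.
rewrite /plane_form; case: d'; last first.
  by apply: H1 crit; rewrite // (inj_eq lift_inj).
move: crit; move: k k' kk; apply: ord3_ind; apply: ord3_ind => // _; rewrite !planeE => crit.
- exact: H3 1 3 isT isT isT crit.
- exact: H2 1 2 isT isT isT crit.
- exact: H2 2 3 isT isT isT crit.
- exact: H3 2 1 isT isT isT crit.
- exact: H3 3 2 isT isT isT crit.
- exact: H2 3 1 isT isT isT crit.
Qed.

(** Criticality of the coordinate planes forces [F] into normal form in the same
    frame. The values at these planes give its diagonal entries, and the values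
    at the mixed planes give the differences of the entries pairing dual planes,
    whose sum is zero by the Bianchi identity. *)
Lemma normal_form_unique (F G : {linear bivector R -> bivector R}) :
  algebraic_bianchi b F -> (forall xi, F (star xi) = star (F xi)) ->
  algebraic_bianchi b G -> (forall xi, G (star xi) = star (G xi)) ->
  normal_frame G e ->
  (forall P, critical_point b G P -> critical_point b F P) ->
  (forall P, critical_point b G P -> quad b F P = quad b G P) ->
  F =1 G.
Proof.
move=> bF cF bG cG nG crit val.
have saF := plane_form_self_adjoint bF.
have nF : normal_frame F e.
  move=> d k d' k' kk; rewrite (plane_form_swap cF).
  apply: critical_plane_orthogonal => //; apply: crit; exact: normal_frame_critical.
have lam k : plane_form b F e false k false k = plane_form b G e false k false k.
  exact: (val _ (normal_frame_critical bG cG false k nG)).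
have mix k : k != 0 -> plane_form b F e false 0 true 0 - plane_form b F e false k true k =
    plane_form b G e false 0 true 0 - plane_form b G e false k true k.
  move=> k0; have := val _ (mixed_plane_critical bG cG k0 nG).
  rewrite !quad_mixed_plane// !lam; lra.
have mu k : plane_form b F e false k true k = plane_form b G e false k true k.
  have := plane_form_bianchi bF cF; have := plane_form_bianchi bG cG.
  have := mix 1 isT; have := mix 2 isT.
  by move: k; apply: ord3_ind; lra.
move=> xi; rewrite (plane_expand bsym blin fe xi) !linear_sum; apply: eq_bigr => k _.
have E d : F (plane e d k) = G (plane e d k).
  rewrite (normal_frame_eigen cF d k nF) (normal_frame_eigen cG d k nG).
  by rewrite lam mu.
by rewrite [LHS]linearD [RHS]linearD !linearZ /= !E.
Qed.

End NormalForm.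

(** * Vector fields and the first Bianchi identity *)

Local Notation dom := Defs.dom.

Section Manifold.
Variables (R : realType) (n : nat) (M : oriented_manifold R n).
Implicit Types (c d e : chart R n M) (X Y Z : vfield M) (f : M -> R).

Definition overlap c d : set 'rV[R]_n := cod c `&` bwd c @^-1` dom d.

Lemma open_cod_preimage c (D : set M) : open D -> open (cod c `&` bwd c @^-1` D).
Proof.
move=> oD; rewrite openE => x [cx Dx].
have N : nbhs x (bwd c @^-1` D).
  by apply: (bwd_continuous cx); exact: open_nbhs_nbhs.
by apply: filterI => //; apply: open_nbhs_nbhs; split=> //; exact: cod_open.
Qed.

Lemma open_overlap c d : open (overlap c d).
Proof. exact/open_cod_preimage/dom_open. Qed.

Lemma near_overlap c d x : overlap c d x -> \forall y \near x, overlap c d y.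
Proof. exact/open_near/open_overlap. Qed.

Lemma near_cod c x : cod c x -> \forall y \near x, cod c y.
Proof. exact/open_near/cod_open. Qed.

Lemma overlap_fwd c d p : dom c p -> dom d p -> overlap c d (fwd c p).
Proof. by move=> cp dp; split; [exact: fwd_cod|rewrite /= fwdK]. Qed.

Lemma overlap_transition c d x : overlap c d x -> overlap d c (transition c d x).
Proof. by move=> [cx dx]; apply: overlap_fwd => //; exact: bwd_dom. Qed.

Lemma transition_fwd c d p : dom c p -> transition c d (fwd c p) = fwd d p.
Proof. by move=> cp; rewrite /transition /= fwdK. Qed.

Lemma transition_differentiable c d x : atlas M c -> atlas M d -> overlap c d x ->
  differentiable (transition c d) x.
Proof. by move=> hc hd ox; exact: (Ck_diff (atlas_smooth hc hd 1%N) ox). Qed.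

Lemma diff_near (V W : normedModType R) (f g : V -> W) (x v : V) : differentiable f x ->
  (\forall y \near x, f y = g y) -> 'd f x v = 'd g x v.
Proof.
move=> df fg; rewrite -!deriveE//; first exact: near_eq_derive.
exact: differentiable_near fg df.
Qed.

Lemma diff_compE (U V W : normedModType R) (f : U -> V) (g : V -> W) x v :
  differentiable f x -> differentiable g (f x) ->
  'd g (f x) ('d f x v) = 'd (g \o f) x v.
Proof. by move=> df dg; rewrite (diff_comp df dg). Qed.

(** The cocycle condition for transition maps, differentiated. It says that the
    components of a vector in two charts are related by the Jacobian of their
    transition. *)
Lemma diff_transition c d e x v : atlas M c -> atlas M d -> atlas M e ->
  overlap c d x -> overlap c e x ->
  'd (transition d e) (transition c d x) ('d (transition c d) x v)
    = 'd (transition c e) x v.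
Proof.
move=> hc hd he od oe.
have ode : overlap d e (transition c d x).
  by split; [exact: fwd_cod od.2|rewrite /= /transition /= fwdK; [exact: oe.2|exact: od.2]].
have d1 := transition_differentiable hc hd od.
have d2 := transition_differentiable hd he ode.
transitivity ('d (transition d e \o transition c d) x v); first exact: diff_compE v d1 d2.
apply: diff_near; first exact: (differentiable_comp d1 d2).
move: (near_overlap od); apply: filterS => y oy.
by rewrite /= /transition /= fwdK//; exact: oy.2.
Qed.

Lemma smooth_fun_differentiable f c x : smooth_fun f -> atlas M c -> cod c x ->
  differentiable (f \o bwd c : 'rV[R]_n -> R) x.
Proof. by move=> sf hc cx; exact: (Ck_diff (sf c hc 1%N) cx). Qed.

Lemma diff_chart_change f c d x v : smooth_fun f -> atlas M c -> atlas M d ->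
  overlap c d x ->
  'd (f \o bwd d : 'rV[R]_n -> R) (transition c d x) ('d (transition c d) x v)
    = 'd (f \o bwd c : 'rV[R]_n -> R) x v.
Proof.
move=> sf hc hd od.
have d1 := transition_differentiable hc hd od.
have d2 : differentiable (f \o bwd d : 'rV[R]_n -> R) (transition c d x).
  by apply: smooth_fun_differentiable => //; exact: fwd_cod od.2.
transitivity ('d ((f \o bwd d : 'rV[R]_n -> R) \o transition c d) x v).
  exact: diff_compE v d1 d2.
apply: diff_near; first exact: (differentiable_comp d1 d2).
move: (near_overlap od); apply: filterS => y oy.
by rewrite /= /transition /= fwdK//; exact: oy.2.
Qed.

Lemma vf_appE X f p : smooth_fun f ->
  vf_app X f p = 'd (f \o bwd (chart_at p) : 'rV[R]_n -> R) (fwd (chart_at p) p) (X p).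
Proof.
move=> sf; rewrite /vf_app deriveE//.
by apply: smooth_fun_differentiable; [|exact: chart_at_atlas|exact/fwd_cod/chart_at_dom].
Qed.

(** The derivative of a function along a field can be computed in any chart, not
    only in the preferred chart of the point. *)
Lemma vf_app_chart X f c x : smooth_fun f -> atlas M c -> cod c x ->
  vf_app X f (bwd c x) = 'd (f \o bwd c : 'rV[R]_n -> R) x (vf_comp X c x).
Proof.
move=> sf hc cx; rewrite vf_appE// /vf_comp /=; set p := bwd c x.
have hp := chart_at_dom p; have cp : dom c p by exact: bwd_dom.
have E := diff_chart_change (X p) sf (chart_at_atlas p) hc (overlap_fwd hp cp).
have xE : fwd c p = x by exact: bwdK.
by rewrite (transition_fwd c hp) xE in E; exact: esym E.
Qed.

Lemma smooth_fun_vf_app X f : smooth_vf X -> smooth_fun f -> smooth_fun (vf_app X f).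
Proof.
move=> sX sf c hc k; have oc := @cod_open _ _ _ c.
have C : Ck k (cod c) (fun x => \sum_i vf_comp X c x 0 i *
    'D_(delta_mx 0 i) (f \o bwd c : 'rV[R]_n -> R) x).
  apply: Ck_sum => // i _; apply: CkM => //.
    exact: (Ck_coord k _ oc).1 (sX c hc k) i.
  by have [_ D] := sf c hc k.+1; exact: D.
apply: Ck_ext oc _ C => x cx.
rewrite /= vf_app_chart// diff_coord_sum//.
exact: smooth_fun_differentiable.
Qed.

Lemma smooth_funD f g : smooth_fun f -> smooth_fun g -> smooth_fun (fun p => f p + g p).
Proof. by move=> sf sg c hc k; apply: CkD; [exact: cod_open|exact: sf|exact: sg]. Qed.

Lemma smooth_funM f g : smooth_fun f -> smooth_fun g -> smooth_fun (fun p => f p * g p).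
Proof. by move=> sf sg c hc k; apply: CkM; [exact: cod_open|exact: sf|exact: sg]. Qed.

Lemma smooth_fun_cst (a : R) : smooth_fun (fun _ : M => a).
Proof. by move=> c hc k; exact: Ck_cst. Qed.

Lemma smooth_vfB X Y : smooth_vf X -> smooth_vf Y -> smooth_vf (fun p => X p - Y p).
Proof.
move=> sX sY c hc k; have oc := @cod_open _ _ _ c.
apply: Ck_ext oc _ (CkB oc (sX c hc k) (sY c hc k)) => x _.
by rewrite /vf_comp linearB.
Qed.

Lemma vf_appB X f g p : smooth_fun f -> smooth_fun g ->
  vf_app X (fun q => f q - g q) p = vf_app X f p - vf_app X g p.
Proof.
move=> sf sg; rewrite /vf_app.
have df h : smooth_fun h -> derivable (h \o bwd (chart_at p) : 'rV[R]_n -> R) (fwd (chart_at p) p) (X p).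
  move=> sh; apply: diff_derivable.
  by apply: smooth_fun_differentiable; [|exact: chart_at_atlas|exact/fwd_cod/chart_at_dom].
by have := deriveB (df f sf) (df g sg).
Qed.

(** Extension by zero: since M is Hausdorff, the image of [K] is closed, so the
    function is zero near every point outside the domain of [c]. *)
Lemma Ck_zero_extension (W : normedModType R) k c d (K : set 'rV[R]_n) (G : 'rV[R]_n -> W) :
  compact K -> K `<=` cod c -> Ck k (overlap d c) G ->
  (forall x, cod d x -> ~ (bwd c @` K) (bwd d x) -> G x = 0) ->
  Ck k (cod d) G.
Proof.
move=> cK Kc CG G0.
have clK : closed (bwd c @` K).
  apply: compact_closed; first exact: carrier_hausdorff.
  apply: continuous_compact => //.
  apply: continuous_in_subspaceT => x; rewrite inE => /Kc.
  exact: bwd_continuous.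
apply: Ck_local => x dx.
have [cx|ncx] := pselect (dom c (bwd d x)); first by exists (overlap d c).
exists (cod d `&` bwd d @^-1` (~` (bwd c @` K))).
  split=> // -[y Ky yx]; apply: ncx; rewrite -yx; apply: bwd_dom; exact: Kc.
have oD := @open_cod_preimage d _ (closed_openC clK).
apply: (Ck_ext oD _ (Ck_cst k _ (0 : W))) => y [dy nK].
by rewrite G0.
Qed.

Definition local_fun c (u : 'rV[R]_n -> R) : M -> R :=
  fun q => if pselect (dom c q) then u (fwd c q) else 0.

(** The field with components [b * v] in the chart [c]: tangent vectors are stored
    by their components in the preferred chart of the point, hence the
    differential of the transition map. *)
Definition local_vf c (b : 'rV[R]_n -> R) (v : 'rV[R]_n) : vfield M :=
  fun q => if pselect (dom c q) then
    b (fwd c q) *: 'd (transition c (chart_at q)) (fwd c q) v else 0.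

Lemma smooth_local_fun c (u : 'rV[R]_n -> R) (K : set 'rV[R]_n) : atlas M c ->
  smooth_on (cod c) u -> compact K -> K `<=` cod c -> (forall x, ~ K x -> u x = 0) ->
  smooth_fun (local_fun c u).
Proof.
move=> hc su cK Kc u0 d hd k; apply: (Ck_zero_extension cK Kc).
  have C : Ck k (overlap d c) (fun x => u (transition d c x)).
    apply: (@Ck_comp _ _ _ _ _ (cod c)); [exact: open_overlap| |exact: su|exact: atlas_smooth].
    by move=> x [_ cx]; exact: fwd_cod.
  apply: Ck_ext (@open_overlap _ _) _ C => x [dx cx].
  by rewrite /local_fun /=; case: pselect.
move=> x dx nK; rewrite /local_fun /=; case: pselect => // cx.
apply: u0 => Kx; apply: nK; exists (fwd c (bwd d x)) => //.
by rewrite fwdK.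
Qed.

Lemma smooth_local_vf c (b : 'rV[R]_n -> R) (K : set 'rV[R]_n) v : atlas M c ->
  smooth_on setT b -> compact K -> K `<=` cod c -> (forall x, ~ K x -> b x = 0) ->
  smooth_vf (local_vf c b v).
Proof.
move=> hc sb cK Kc b0 d hd k; apply: (Ck_zero_extension cK Kc).
  have oo := @open_overlap d c.
  have Ct : Ck k (overlap d c) (transition d c) by exact: atlas_smooth.
  have C1 : Ck k (overlap d c) (fun x => b (transition d c x)).
    exact: (@Ck_comp _ _ _ _ _ setT _ b oo (fun _ _ => I) (sb k) Ct).
  have C2 : Ck k (overlap d c) (fun x => 'D_v (transition c d) (transition d c x)).
    have [_ D] := atlas_smooth hc hd k.+1.
    have oc := @open_overlap c d.
    exact: (Ck_comp_vec oo oc (@overlap_transition d c) (D v) Ct).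
  have C : Ck k (overlap d c) (fun x => b (transition d c x) *:
      'D_v (transition c d) (transition d c x)).
    apply/(Ck_coord _ _ oo) => i.
    have := CkM oo C1 ((Ck_coord _ _ oo).1 C2 i).
    by apply: Ck_ext oo _ => x _; rewrite mxE.
  apply: Ck_ext oo _ C => x [dx cx].
  rewrite /vf_comp /local_vf /=; case: pselect => // cx'.
  set q := bwd d x; have aq := chart_at_dom q.
  have oq : overlap c (chart_at q) (fwd c q) by exact: overlap_fwd.
  have od : overlap c d (fwd c q) by apply: overlap_fwd => //; exact: bwd_dom.
  rewrite linearZ /=; congr (_ *: _).
  have E := diff_transition v hc (chart_at_atlas q) hd oq od.
  rewrite (transition_fwd (chart_at q) cx') in E.
  transitivity ('d (transition c d) (transition d c x) v); last exact: esym E.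
  by rewrite deriveE//; exact: transition_differentiable.
move=> x dx nK; rewrite /vf_comp /local_vf /=; case: pselect => [cx|nc]; last by rewrite linear0.
rewrite b0 ?scale0r ?linear0// => Kx; apply: nK; exists (fwd c (bwd d x)) => //.
by rewrite fwdK.
Qed.

Lemma diff_transition_id c x v : atlas M c -> cod c x -> 'd (transition c c) x v = v.
Proof.
move=> hc cx; have oc : overlap c c x by split=> //; exact: bwd_dom.
transitivity ('d (id : 'rV[R]_n -> 'rV[R]_n) x v); last by rewrite diff_val.
apply: diff_near; first exact: transition_differentiable.
by move: (near_cod cx); apply: filterS => y cy; rewrite /transition /= bwdK.
Qed.

(** The same bump function serves for all [v], so a basis of vectors extends to
    fields which are a basis wherever the function is not zero. *)
Lemma extend_frame p : exists (b : M -> R) (E : 'rV[R]_n -> vfield M),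
  b p != 0 /\ forall v, smooth_vf (E v) /\ E v p = b p *: v.
Proof.
set c := chart_at p; have hc := chart_at_atlas p; have cp := chart_at_dom p.
have [b [K [sb bp cK Kc b0]]] := bump_open (@cod_open _ _ _ c) (fwd_cod cp).
exists (fun q => b (fwd c q)), (local_vf c b); split=> // v; split.
  exact: smooth_local_vf Kc b0.
rewrite /local_vf; case: pselect => // cp'; rewrite diff_transition_id//.
exact: fwd_cod.
Qed.

Lemma extend_vector p v : exists2 X : vfield M, smooth_vf X & X p = v.
Proof.
have [b [E [bp H]]] := extend_frame p; have [sE Ep] := H ((b p)^-1 *: v).
by exists (E ((b p)^-1 *: v)) => //; rewrite Ep scalerA divff// scale1r.
Qed.

(** The test functions are bump functions times the coordinates centred at [p]. *)
Lemma tangent_eq0 p (v : 'rV[R]_n) :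
  (forall f, smooth_fun f ->
     'd (f \o bwd (chart_at p) : 'rV[R]_n -> R) (fwd (chart_at p) p) v = 0) -> v = 0.
Proof.
move=> H; set c := chart_at p; have hc := chart_at_atlas p; have cp := chart_at_dom p.
have oc := @cod_open _ _ _ c; have cx := fwd_cod cp; set a := fwd c p in cx *.
have [b [K [sb ba cK Kc b0]]] := bump_open oc cx.
apply/rowP => i; rewrite mxE.
pose w (x : 'rV[R]_n) : R := x 0 i - a 0 i.
have sw : smooth_on (cod c) w.
  move=> k; apply: CkB; [exact: oc| |exact: Ck_cst].
  exact: Ck_proj oc.
pose u x := b x * w x.
have su : smooth_on (cod c) u.
  by move=> k; apply: CkM => //; exact: Ck_sub (sb k).
have u0 x : ~ K x -> u x = 0 by move=> nK; rewrite /u b0// mul0r.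
have du : 'd u a v = 0.
  rewrite -[RHS](H _ (smooth_local_fun hc su cK Kc u0)).
  apply: diff_near; first exact: (Ck_diff (su 1%N) cx).
  move: (near_cod cx); apply: filterS => y cy; rewrite /local_fun /=.
  by case: pselect => [dy|]; [rewrite bwdK|case; exact: bwd_dom].
have db : differentiable b a by exact: (Ck_diff (sb 1%N)).
have dw : differentiable w a by exact: (Ck_diff (sw 1%N) cx).
have dwv : 'd w a v = v 0 i.
  rewrite -deriveE//.
  have dc := @differentiable_coord R 1 n a 0 i.
  have := deriveB (diff_derivable (v := v) dc) (derivable_cst (a 0 i) a v).
  rewrite derive_cst subr0 => E; transitivity ('D_v (fun x : 'rV[R]_n => x 0 i : R) a).
    exact: E.
  have := derive_mx (@derivable_id R 'rV[R]_n a v).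
  by rewrite derive_id => /matrixP /(_ 0 i); rewrite mxE.
have E : 'd u a v = b a * 'd w a v + w a * 'd b a v.
  by rewrite [LHS](congr1 (fun h => h v) (diffM db dw)).
have wa : w a = 0 by rewrite /w subrr.
move/eqP: du; rewrite {}E dwv wa mul0r addr0 mulf_eq0 => /orP[|/eqP//].
by rewrite (negbTE ba).
Qed.

Lemma commutator_jacobi (xyz xzy yzx yxz zxy zyx : R) :
  (xyz - xzy - (yzx - zyx)) + (yzx - yxz - (zxy - xzy))
    + (zxy - zyx - (xyz - yxz)) = 0.
Proof. ring. Qed.

(** Vector fields are separated by their action on functions, where the brackets
    are commutators. *)
Lemma jacobi_identity X Y Z XY YZ ZX J1 J2 J3 :
  smooth_vf X -> smooth_vf Y -> smooth_vf Z ->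
  is_lie_bracket X Y XY -> is_lie_bracket Y Z YZ -> is_lie_bracket Z X ZX ->
  is_lie_bracket X YZ J1 -> is_lie_bracket Y ZX J2 -> is_lie_bracket Z XY J3 ->
  forall p, J1 p + J2 p + J3 p = 0.
Proof.
move=> sX sY sZ [sXY bXY] [sYZ bYZ] [sZX bZX] [_ b1] [_ b2] [_ b3] p.
apply: (@tangent_eq0 p) => f sf.
rewrite !linearD /= -!vf_appE// b1// b2// b3//.
have sX' g : smooth_fun g -> smooth_fun (vf_app X g) by exact: smooth_fun_vf_app.
have sY' g : smooth_fun g -> smooth_fun (vf_app Y g) by exact: smooth_fun_vf_app.
have sZ' g : smooth_fun g -> smooth_fun (vf_app Z g) by exact: smooth_fun_vf_app.
rewrite bYZ ?bZX ?bXY; try by auto.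
have -> : vf_app YZ f = fun q => vf_app Y (vf_app Z f) q - vf_app Z (vf_app Y f) q.
  by apply/funext => q; exact: bYZ.
have -> : vf_app ZX f = fun q => vf_app Z (vf_app X f) q - vf_app X (vf_app Z f) q.
  by apply/funext => q; exact: bZX.
have -> : vf_app XY f = fun q => vf_app X (vf_app Y f) q - vf_app Y (vf_app X f) q.
  by apply/funext => q; exact: bXY.
rewrite !vf_appB; try by auto.
exact: commutator_jacobi.
Qed.

End Manifold.

Section Bianchi.
Variables (R : realType) (M : oriented_manifold R 4) (g : form_field M).
Hypothesis hg : lorentzian_metric g.
Variable nabla : vfield M -> vfield M -> vfield M.
Hypothesis hnabla : levi_civita g nabla.

(** By torsion-freeness the cyclic sum of the curvature is the cyclic sum of the
    double brackets, which vanishes by the Jacobi identity. The vectors at [p] are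
    extended to fields in order to apply the definition of the curvature. *)
Lemma first_bianchi (Rm : M -> 'rV[R]_4 -> 'rV[R]_4 -> 'rV[R]_4 -> 'rV[R]_4 -> R) :
  is_curvature_tensor g nabla Rm ->
  forall p a b c d, Rm p a b c d + Rm p b c a d + Rm p c a b d = 0.
Proof.
move=> hRm p a b c d.
have [A sA <-] := extend_vector p a; have [B sB <-] := extend_vector p b.
have [C sC <-] := extend_vector p c; have [D sD <-] := extend_vector p d.
pose br X Y : vfield M := fun q => nabla X Y q - nabla Y X q.
have hbr X Y : smooth_vf X -> smooth_vf Y -> is_lie_bracket X Y (br X Y).
  by move=> sX sY; exact: (lc_torsion_free hnabla sX sY).
have sbr X Y : smooth_vf X -> smooth_vf Y -> smooth_vf (br X Y).
  by move=> sX sY; case: (hbr _ _ sX sY).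
have sn := lc_smooth hnabla.
rewrite (hRm A B C D _ sA sB sC sD (hbr _ _ sA sB)).
rewrite (hRm B C A D _ sB sC sA sD (hbr _ _ sB sC)).
rewrite (hRm C A B D _ sC sA sB sD (hbr _ _ sC sA)).
rewrite -!(formDl (lor_sym hg p) (lor_lin hg p)).
have J := jacobi_identity sA sB sC (hbr _ _ sA sB) (hbr _ _ sB sC) (hbr _ _ sC sA)
  (hbr _ _ sA (sbr _ _ sB sC)) (hbr _ _ sB (sbr _ _ sC sA)) (hbr _ _ sC (sbr _ _ sA sB)) p.
have E X Y Z : smooth_vf X -> smooth_vf Y -> smooth_vf Z ->
    nabla X (nabla Y Z) p = nabla X (nabla Z Y) p + nabla X (br Y Z) p.
  move=> sX sY sZ; rewrite -(lc_additive hnabla); [|exact: sX|exact: sn|exact: sbr].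
  by congr (nabla X _ p); apply/funext => q; rewrite /br addrC subrK.
rewrite (E A B C)// (E B C A)// (E C A B)//.
set u := (X in g p X _); have -> : u = 0.
  rewrite -[RHS]J /u /br -/(br A B) -/(br B C) -/(br C A).
  move: (nabla A (nabla C B) p) (nabla B (nabla A C) p) (nabla C (nabla B A) p) => x y z.
  move: (nabla A _ p) (nabla B _ p) (nabla C _ p) (nabla _ A p) (nabla _ B p) (nabla _ C p).
  move=> a1 a2 a3 a4 a5 a6.
  apply/rowP => i; rewrite !mxE; ring.
by rewrite (lor_sym hg) (form0r (lor_lin hg p)).
Qed.
End Bianchi.

(** * Smooth matrices and frames adapted to a timelike vector *)

Section SmoothDeterminant.
Variables (R : realType) (V : normedModType R).

Lemma Ck_det k m (U : set V) (A : V -> 'M[R]_m) : open U ->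
  (forall i j, Ck k U (fun x => A x i j)) -> Ck k U (fun x => \det (A x)).
Proof.
move=> oU CA; rewrite /determinant; apply: Ck_sum => // s _.
by apply: CkM => //; [exact: Ck_cst|apply: Ck_prod].
Qed.

Lemma Ck_adj k m (U : set V) (A : V -> 'M[R]_m) i j : open U ->
  (forall i j, Ck k U (fun x => A x i j)) -> Ck k U (fun x => \adj (A x) i j).
Proof.
move=> oU CA.
have -> : (fun x => \adj (A x) i j) = (fun x => (-1) ^+ (j + i) * \det (row' j (col' i (A x)))).
  by apply/funext => x; rewrite mxE.
apply: CkM => //; first exact: Ck_cst.
apply: Ck_det => // i' j'.
have -> : (fun x => row' j (col' i (A x)) i' j') = (fun x => A x (lift j i') (lift i j')).
  by apply/funext => x; rewrite !mxE.
exact: CA.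
Qed.

Lemma Ck_trace_mul k m (U : set V) (A B : V -> 'M[R]_m) : open U ->
  (forall i j, Ck k U (fun x => A x i j)) -> (forall i j, Ck k U (fun x => B x i j)) ->
  Ck k U (fun x => \tr (A x *m B x)).
Proof.
move=> oU CA CB; rewrite /mxtrace; apply: Ck_sum => // i _.
have -> : (fun x => (A x *m B x) i i) = (fun x => \sum_j A x i j * B x j i).
  by apply/funext => x; rewrite mxE.
by apply: Ck_sum => // j _; apply: CkM.
Qed.
End SmoothDeterminant.

Section LorentzFrame.
Variables (R : realType) (g : 'rV[R]_4 -> 'rV[R]_4 -> R).
Hypothesis gsym : forall u v, g u v = g v u.
Hypothesis glin : forall u (a : R) v w, g u (a *: v + w) = a * g u v + g u w.
Variable e : 'I_4 -> 'rV[R]_4.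
Hypothesis ge : forall i j, g (e i) (e j) = if i == j then (if i == 0 then -1 else 1) else 0.
Variable t : 'rV[R]_4.
Hypothesis gt : g t t = -1.

Lemma lorentz_expand : exists x : 'I_4 -> R, t = \sum_i x i *: e i.
Proof.
pose B : 'M[R]_4 := \matrix_(i, j) g (delta_mx 0 i) (delta_mx 0 j).
pose E : 'M[R]_4 := \matrix_i e i.
pose D : 'M[R]_4 := diag_mx (\row_i (if i == 0 then -1 else 1)).
have H : E *m (B *m E^T) = D.
  rewrite (gram_matrix gsym glin); apply/matrixP => i j; rewrite !mxE ge.
  by case: eqVneq => //; rewrite ?mulr1n ?mulr0n.
have DD : D *m D = 1%:M.
  rewrite /D mulmx_diag -diag_const_mx; congr diag_mx.
  by apply/rowP => i; rewrite !mxE; case: ifP; rewrite ?mulr1 ?mulN1r ?opprK.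
pose X := B *m E^T *m D.
have XE : X *m E = 1%:M by apply: mulmx1C; rewrite /X mulmxA H DD.
have tE : t = t *m X *m E by rewrite -mulmxA XE mulmx1.
exists (fun i => (t *m X) 0 i); rewrite {1}tE; move: (t *m X) => y.
by apply/rowP => j; rewrite mxE summxE; apply: eq_bigr => k _; rewrite !mxE.
Qed.

(** The Lorentzian reflection which exchanges [t] with [e 0] or [- e 0] carries [e]
    to a [g]-orthonormal frame whose first vector is [t] or [- t]; changing the
    sign of the square of that vector makes the frame orthonormal. *)
Lemma wick_frame : exists f : 'I_4 -> 'rV[R]_4,
  orthonormal_frame (fun u v => g u v + 2 * (g t u * g t v)) f.
Proof.
have gDr := formDr glin; have gZr := formZr glin; have gNr := formNr glin.
have gDl := formDl gsym glin; have gZl := formZl gsym glin; have gNl := formNl gsym glin.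
have [x tx] := lorentz_expand.
(* Two unit timelike vectors are never almost orthogonal; the sign s is chosen
   so that the vector n = t + s e0 of the reflection is far from being null. *)
have te0 : 1 <= g t (e 0) ^+ 2.
  have te i : g t (e i) = x i * (if i == 0 then -1 else 1).
    rewrite {1}tx sum4 !gDl !gZl !ge; move: i; apply: ord4_ind => /=; ring.
  have := gt; rewrite {2}tx sum4 !gDr !gZr !te /= => E.
  have := sqr_ge0 (x 1); have := sqr_ge0 (x 2); have := sqr_ge0 (x 3); nra.
pose s : R := if 0 <= g t (e 0) then -1 else 1.
have s1 : s * s = 1 by rewrite /s; case: ifP; rewrite ?mulN1r ?opprK ?mulr1.
have ste : s * g t (e 0) <= -1.
  by rewrite /s; case: ifPn => h; [|rewrite -ltNge in h]; nra.
pose u0 := - s *: e 0; pose n := t - u0.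
have gn v : g v n = g v t + s * g v (e 0).
  by rewrite /n /u0 gDr gNr gZr mulNr opprK.
have nn : g n n = -2 + 2 * (s * g t (e 0)).
  rewrite gn (gsym n) gn (gsym n) gn gt (gsym (e 0) t) ge /=.
  transitivity (-1 + 2 * (s * g t (e 0)) - s * s); first ring.
  by rewrite s1; ring.
have nn0 : g n n != 0 by rewrite nn lt_eqF//; lra.
clearbody n; pose N := g n n.
pose f i := e i + (- 2 * g (e i) n / N) *: n.
have gff i j : g (f i) (f j) = g (e i) (e j).
  rewrite /f !gDl !gDr !gZl !gZr (gsym n (e j)) -/N; field; exact: nn0.
have gtf i : g t (f i) = - s * g (e 0) (e i).
  rewrite /f gDr gZr.
  have -> : g t n = N / 2 by rewrite /N nn gn gt; field.
  rewrite gn (gsym (e i) t) (gsym (e i) (e 0)); field; exact: nn0.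
exists f => i j; rewrite gff !gtf.
have -> : - s * g (e 0) (e i) * (- s * g (e 0) (e j)) = s * s * (g (e 0) (e i) * g (e 0) (e j)) by ring.
rewrite s1 mul1r !ge; move: i j; apply: ord4_ind; apply: ord4_ind; rewrite /=; ring.
Qed.
End LorentzFrame.

(** * The trace of the curvature *)

Section WickRotation.
Variables (R : realType) (M : oriented_manifold R 4) (g : form_field M).
Hypothesis hg : lorentzian_metric g.
Variable T : vfield M.
Hypothesis hT : smooth_vf T.
Hypothesis hTunit : forall p, g p (T p) (T p) = -1.
Local Notation h := (wick_metric g T).

Lemma wick_sym p u v : h p u v = h p v u.
Proof. by rewrite /wick_metric (lor_sym hg) [g p _ u * _]mulrC. Qed.

Lemma wick_lin p u a v w : h p u (a *: v + w) = a * h p u v + h p u w.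
Proof. by rewrite /wick_metric !(lor_lin hg); ring. Qed.

Lemma wick_unit p : h p (T p) (T p) = 1.
Proof. by rewrite /wick_metric !hTunit; ring. Qed.

Lemma wick_frame_exists p : exists e, orthonormal_frame (h p) e.
Proof.
have [e ge] := lor_signature hg p.
exact: (wick_frame (lor_sym hg p) (lor_lin hg p) ge (hTunit p)).
Qed.

Lemma smooth_wick X Y : smooth_vf X -> smooth_vf Y -> smooth_fun (fun p => h p (X p) (Y p)).
Proof.
move=> sX sY; have sg := lor_smooth hg.
apply: smooth_funD; first exact: sg.
by apply: smooth_funM; [exact: smooth_fun_cst|apply: smooth_funM; exact: sg].
Qed.

Variable nabla : vfield M -> vfield M -> vfield M.
Hypothesis hnabla : levi_civita g nabla.
Variable Rm : M -> 'rV[R]_4 -> 'rV[R]_4 -> 'rV[R]_4 -> 'rV[R]_4 -> R.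
Hypothesis hRm : is_curvature_tensor g nabla Rm.

Lemma smooth_curvature A B C D : smooth_vf A -> smooth_vf B -> smooth_vf C -> smooth_vf D ->
  smooth_fun (fun p => Rm p (A p) (B p) (C p) (D p)).
Proof.
move=> sA sB sC sD; have sn := lc_smooth hnabla.
have br := lc_torsion_free hnabla sA sB; have [sAB _] := br.
rewrite (_ : (fun _ => _) = fun p => g p (nabla A (nabla B C) p - nabla B (nabla A C) p
  - nabla (fun p => nabla A B p - nabla B A p) C p) (D p)).
  apply: (lor_smooth hg (X := fun p => nabla A (nabla B C) p - nabla B (nabla A C) p
    - nabla (fun p => nabla A B p - nabla B A p) C p)) => //.
  by apply: smooth_vfB; [apply: smooth_vfB|]; auto.
by apply/funext => p; exact: hRm.
Qed.

Hypothesis Rm_bilinear : forall p x y, bilinear_form (fun u v => Rm p u x y v).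

(** Near a point, extended basis vectors are a smooth basis [F], and
    [trace_in_basis] writes the trace as a rational function of smooth functions
    whose denominator, the Gram determinant of [F], does not vanish. *)
Lemma smooth_trace X Y (f : M -> R) : smooth_vf X -> smooth_vf Y ->
  (forall p, exists2 e, orthonormal_frame (h p) e & f p = \sum_i Rm p (e i) (X p) (Y p) (e i)) ->
  smooth_fun f.
Proof.
move=> sX sY hf c hc k; apply: Ck_local => x cx.
pose p := bwd c x; have [b [E [bp HE]]] := extend_frame p.
pose F i := E (delta_mx 0 i).
have sF i : smooth_vf (F i) by have [] := HE (delta_mx 0 i).
pose G q : 'M[R]_4 := \matrix_(i, j) h q (F i q) (F j q).
pose S q : 'M[R]_4 := \matrix_(i, j) Rm q (F i q) (X q) (Y q) (F j q).
have oc := @cod_open _ _ _ c.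
have CG i j : Ck k (cod c) (fun y => G (bwd c y) i j).
  have := smooth_wick (sF i) (sF j) hc k.
  by apply: Ck_ext oc _ => y _; rewrite mxE.
have CS i j : Ck k (cod c) (fun y => S (bwd c y) i j).
  have := smooth_curvature (sF i) sX sY (sF j) hc k.
  by apply: Ck_ext oc _ => y _; rewrite mxE.
pose d y := \det (G (bwd c y)).
have Cd l : Ck l (cod c) d.
  apply: Ck_det => // i j.
  have := smooth_wick (sF i) (sF j) hc l.
  by apply: Ck_ext oc _ => y _; rewrite mxE.
pose D : set 'rV[R]_4 := [set y | cod c y /\ d y != 0].
have oD : open D.
  rewrite openE => y [cy dy].
  have cont : {for y, continuous d} by exact: (Cd 0%N y cy).
  have N : \forall z \near y, d z != 0.
    exact: (cont _ (open_nbhs_nbhs (conj (@open_neq _ 0) dy))).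
  exact: (filterI (near_cod cy) N).
have dx : d x != 0.
  rewrite /d -/p; have [e fe] := wick_frame_exists p.
  have -> : G p = (b p ^+ 2) *: \matrix_(i, j) h p (delta_mx 0 i) (delta_mx 0 j).
    have FE i : F i p = b p *: delta_mx 0 i by have [] := HE (delta_mx 0 i).
    apply/matrixP => i j; rewrite !mxE !FE.
    by rewrite (formZl (wick_sym p) (wick_lin p)) (formZr (wick_lin p)) mulrA expr2.
  rewrite detZ mulf_neq0 ?expf_neq0//.
  exact: (gram_det_neq0 (wick_sym p) (wick_lin p) fe).
exists D; first by [].
have DC : D `<=` cod c by move=> y [].
have C : Ck k D (fun y => \tr (\adj (G (bwd c y)) *m S (bwd c y)) / d y).
  apply: CkM => //.
    have CA i j : Ck k D (fun y => \adj (G (bwd c y)) i j).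
      apply: (Ck_adj (A := fun y => G (bwd c y)) i j oD) => i' j'.
      exact: (Ck_sub DC (CG i' j')).
    exact: (Ck_trace_mul oD CA (fun i j => Ck_sub DC (CS i j))).
  by apply: CkV => //; [move=> y []|exact: (Ck_sub DC (Cd k))].
apply: Ck_ext oD _ C => y [cy dy]; have [e fe fE] := hf (bwd c y).
rewrite /= fE; symmetry.
exact: (trace_in_basis (wick_sym _) (wick_lin _) (Rm_bilinear _ _ _) fe dy).
Qed.

End WickRotation.

Theorem theorem7 (R : realType) (M : oriented_manifold R 4)
    (g : form_field M) (hg : lorentzian_metric g)
    (T : vfield M) (hT : smooth_vf T) (hTunit : forall p, g p (T p) (T p) = -1)
    (nabla : vfield M -> vfield M -> vfield M) (hnabla : levi_civita g nabla)
    (Rm : M -> 'rV[R]_4 -> 'rV[R]_4 -> 'rV[R]_4 -> 'rV[R]_4 -> R)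
    (hRm : is_curvature_tensor g nabla Rm)
    (star : M -> {linear bivector R -> bivector R})
    (hstar : forall p, is_hodge_star (wick_metric g T p) (star p))
    (Rhat : M -> {linear bivector R -> bivector R})
    (hRhat : forall p,
       is_curvature_operator (wick_metric g T p) (Rm p) (Rhat p)) :
  (* (a) *)
  (star_einstein star Rhat <->
   exists f : M -> R, smooth_fun f /\
     forall (p : M) (e : 'I_4 -> 'rV[R]_4),
       orthonormal_frame (wick_metric g T p) e ->
       forall x y : 'rV[R]_4,
         \sum_i Rm p (e i) x y (e i) = f p * wick_metric g T p x y) /\
  (* (b) *)
  (star_einstein star Rhat -> forall p : M,
    (exists e : 'I_4 -> 'rV[R]_4,
       [/\ orthonormal_frame (wick_metric g T p) e,
           forall P : bivector R,
             P \in [:: wedge (e 0) (e 1); wedge (e 0) (e 2); wedge (e 0) (e 3);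
                       wedge (e 2) (e 3); wedge (e 3) (e 1); wedge (e 1) (e 2)]
             -> critical_point (wick_metric g T p) (Rhat p) P &
           exists lambda mu : 'I_3 -> R, forall i : 'I_3,
             let P := wedge (e 0) (e (lift ord0 i)) in
             Rhat p P = lambda i *: P + mu i *: star p P /\
             Rhat p (star p P) = mu i *: P + lambda i *: star p P]) /\
    (forall F : {linear bivector R -> bivector R},
       self_adjoint (wick_metric g T p) F ->
       (forall xi, F (star p xi) = star p (F xi)) ->
       algebraic_bianchi (wick_metric g T p) F ->
       (forall P, critical_point (wick_metric g T p) F P <->
                  critical_point (wick_metric g T p) (Rhat p) P) ->
       (forall P, critical_point (wick_metric g T p) (Rhat p) P ->
          quad (wick_metric g T p) F P =
          quad (wick_metric g T p) (Rhat p) P) ->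
       F =1 Rhat p)).
Proof.
have hs p : forall u v, wick_metric g T p u v = wick_metric g T p v u by exact: wick_sym.
have hl p : forall u a v w, wick_metric g T p u (a *: v + w)
    = a * wick_metric g T p u v + wick_metric g T p u w by exact: wick_lin.
have frame p := wick_frame_exists hg hTunit p.
have RmE p v w x y : Rm p v w x y = - op_form (wick_metric g T p) (Rhat p) v w x y.
  by rewrite /op_form hRhat opprK.
have bianchi p : algebraic_bianchi (wick_metric g T p) (Rhat p).
  move=> x y z w; rewrite !hRhat -!opprD (first_bianchi hg hnabla hRm) oppr0//.
pose ric p (e : 'I_4 -> 'rV[R]_4) x y := \sum_i Rm p (e i) x y (e i).
have ricE p e x y : ric p e x y = \sum_i op_form (wick_metric g T p) (Rhat p) (e i) x (e i) y.
  by apply: eq_bigr => i _; rewrite RmE (op_anti2 (hs p)) opprK.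
have ric_bilinear p e : bilinear_form (ric p e).
  split=> a v v' w; rewrite !ricE mulr_sumr -big_split; apply: eq_bigr => i _ /=.
    by rewrite op_lin2.
  by rewrite (op_lin4 (hs p)).
have Rm_bilinear p x y : bilinear_form (fun u v => Rm p u x y v).
  by split=> a v v' w; rewrite !RmE ?op_lin1 ?(op_lin4 (hs p)); ring.
have ric_frame p e e' x y : orthonormal_frame (wick_metric g T p) e ->
    orthonormal_frame (wick_metric g T p) e' -> ric p e x y = ric p e' x y.
  move=> fe fe'.
  have G1 : \matrix_(i, j) wick_metric g T p (e i) (e j) = 1%:M.
    by apply/matrixP => i j; rewrite !mxE fe.
  have d1 : \det (\matrix_(i, j) wick_metric g T p (e i) (e j)) != 0.
    by rewrite G1 det1 oner_neq0.
  rewrite /ric (trace_in_basis (hs p) (hl p) (Rm_bilinear p x y) fe d1).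
  by rewrite (trace_in_basis (hs p) (hl p) (Rm_bilinear p x y) fe' d1).
(* Part (a), with the function f defined by evaluation at the unit vector T. *)
split; first split.
- move=> comm.
  pose e p := sval (cid (frame p)); have fe p : orthonormal_frame _ (e p) := svalP (cid (frame p)).
  exists (fun p => ric p (e p) (T p) (T p)); split.
    apply: (smooth_trace hg hT hTunit hnabla hRm Rm_bilinear hT hT) => p.
    by exists (e p); [exact: fe|].
  move=> p e' fe' x y; rewrite -/(ric p e' x y).
  have [f hf] := (commute_iff_ricci (hs p) (hl p) (bianchi p) (fe p) (hstar p)).1 (comm p).
  have E u v : ric p (e p) u v = f * wick_metric g T p u v.
    apply: (bilinear_frame_eq (hs p) (hl p) (ric_bilinear p (e p)) (fe p)) => j k.
    by rewrite ricE hf.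
  by rewrite (ric_frame p e' (e p))// !E wick_unit// mulr1.
- move=> [f [_ hf]] p; have [e fe] := frame p.
  apply/(commute_iff_ricci (hs p) (hl p) (bianchi p) fe (hstar p)).
  by exists (f p) => j k; rewrite -ricE /ric hf// fe.
move=> comm p; have [u fu] := frame p.
have [e fe ne] := normal_frame_exists (hs p) (hl p) (hstar p) fu (bianchi p) (comm p).
split; last first.
  move=> F _ cF bF crit val.
  apply: (normal_form_unique (hs p) (hl p) (hstar p) fe bF cF (bianchi p) (comm p) ne) => //.
  by move=> P /crit.
exists e; split=> //.
  have C d k := normal_frame_critical (hs p) (hl p) (hstar p) fe (bianchi p) (comm p) d k ne.
  have := (C false 0, C false 1, C false 2, (C true 0, C true 1, C true 2)).
  rewrite !planeE => -[[[C1 C2] C3] [[C4 C5] C6]] P.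
  by rewrite !inE => /orP[/eqP->|/orP[/eqP->|/orP[/eqP->|/orP[/eqP->|/orP[/eqP->|/eqP->]]]]].
have [s s1 se] := star_frame (hs p) (hl p) (hstar p) fe.
pose m := plane_form (wick_metric g T p) (Rhat p) e.
exists (fun k => m false k false k), (fun k => s * m false k true k) => k /=.
rewrite -[wedge (e 0) _]/(plane e false k).
have E : Rhat p (plane e false k) = m false k false k *: plane e false k
    + (s * m false k true k) *: star p (plane e false k).
  rewrite (normal_frame_eigen (hs p) (hl p) (hstar p) fe (comm p) false k ne).
  by rewrite (star_plane se) scalerA mulrAC s1 mul1r.
split; first exact: E.
rewrite (comm p) E linearD !linearZ /= (star_star (hs p) (hl p) fe s1 se).
by rewrite addrC.
Qed.
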